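(* Let $E=TM\oplus T^*M\oplus\mathcal G$ be a standard Courant algebroid with quadratic Lie algebra bundle $(\mathcal G,[\cdot,\cdot]_{\mathcal G},\langle\cdot,\cdot\rangle)$ and data $(\nabla,R,H)$. A generalised almost complex structure $\mathcal J$ on $E$ with components $J,A,B,C,\mu,\nu$ is integrable if and only if the following ten relations hold for all $X,Y\in\mathfrak X(M)$, $\xi,\eta\in\Omega^1(M)$, $r,\tilde r\in\Gamma(\mathcal G)$: (1) $\mathcal L_{JX}(JY)-\mathcal L_XY-J\mathcal L_X(JY)+J\mathcal L_Y(JX)+B\big(i_Xi_{JY}H+i_{JX}i_YH+i_Xi_Y(dC)-C\mathcal L_XY\big)+2B\big(\langle i_XR,\mu Y\rangle-\langle i_YR,\mu X\rangle\big)+\nu^*\big(R(X,JY)-R(Y,JX)+\nabla_X(\mu Y)-\nabla_Y(\mu X)\big)=0$; (2) $i_{JY}i_{JX}H-i_Yi_XH+J^*\big(i_{JY}i_XH-i_{JX}i_YH\big)+2\langle i_{JY}R,\mu X\rangle-2\langle i_{JX}R,\mu Y\rangle-2J^*\big(\langle i_XR,\mu Y\rangle-\langle i_YR,\mu X\rangle\big)+(\mathcal L_{JX}C)Y-(\mathcal L_{JY}C)X+d(C(X,JY))+J^*\big(i_Yi_X(dC)+C\mathcal L_XY\big)+2\langle\nabla(\mu X),\mu Y\rangle+\mu^*\big(R(X,JY)+R(JX,Y)+\nabla_X(\mu Y)-\nabla_Y(\mu X)\big)=0$; (3) $R(JX,JY)-R(X,Y)+\nabla_{JX}(\mu Y)-\nabla_{JY}(\mu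 X)+[\mu X,\mu Y]_{\mathcal G}-\mu\big(\mathcal L_X(JY)-\mathcal L_Y(JX)\big)+\nu\big(i_Xi_{JY}H+i_{JX}i_YH+i_Xi_Y(dC)-C\mathcal L_XY\big)+2\nu\big(\langle i_XR,\mu Y\rangle-\langle i_YR,\mu X\rangle\big)-A\big(R(X,JY)-R(Y,JX)+\nabla_X(\mu Y)-\nabla_Y(\mu X)\big)=0$; (4) $\mathcal L_{B\xi}(B\eta)-B\big(\mathcal L_{B\xi}\eta-\mathcal L_{B\eta}\xi\big)+B\,d(B(\xi,\eta))=0$; (5) $\mathcal L_{B\eta}(J^*\xi)-\mathcal L_{B\xi}(J^*\eta)+d(B(J^*\xi,\eta))+J^*\big(\mathcal L_{B\xi}\eta-\mathcal L_{B\eta}\xi-d(B(\xi,\eta))\big)-2\big(\langle i_{B\xi}R,\nu\eta\rangle-\langle i_{B\eta}R,\nu\xi\rangle\big)+2\langle\nabla(\nu\xi),\nu\eta\rangle+i_{B\eta}i_{B\xi}H=0$; (6) $R(B\xi,B\eta)+\nabla_{B\xi}(\nu\eta)-\nabla_{B\eta}(\nu\xi)+[\nu\xi,\nu\eta]_{\mathcal G}-\nu\big(\mathcal L_{B\xi}\eta-\mathcal L_{B\eta}\xi-d(B(\xi,\eta))\big)=0$; (7) $\mathcal L_{\nu^*r}(\nu^*\tilde r)-2B\big(\langle i_{\nu^*r}R,\tilde r\rangle-\langle i_{\nu^*\tilde r}R,r\rangle+\langle(\nabla A)r,\tilde r\rangle\big)+\nu^*\big([Ar,\tilde r]_{\mathcal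 G}-[A\tilde r,r]_{\mathcal G}-\nabla_{\nu^*r}\tilde r+\nabla_{\nu^*\tilde r}r\big)=0$; (8) $i_{\nu^*\tilde r}i_{\nu^*r}H+\mathcal L_{\nu^*r}(\mu^*\tilde r)-\mathcal L_{\nu^*\tilde r}(\mu^*r)+2d\langle\mu^*r,\nu^*\tilde r\rangle+2\big(\langle i_{\nu^*r}R,A\tilde r\rangle-\langle i_{\nu^*\tilde r}R,Ar\rangle+\langle\nabla(Ar),A\tilde r\rangle-\langle\nabla r,\tilde r\rangle\big)+2J^*\big(\langle i_{\nu^*r}R,\tilde r\rangle-\langle i_{\nu^*\tilde r}R,r\rangle+\langle(\nabla A)r,\tilde r\rangle\big)+\mu^*\big([Ar,\tilde r]_{\mathcal G}+[r,A\tilde r]_{\mathcal G}-\nabla_{\nu^*r}\tilde r+\nabla_{\nu^*\tilde r}r\big)=0$; (9) $[Ar,A\tilde r]_{\mathcal G}-[r,\tilde r]_{\mathcal G}-A\big([Ar,\tilde r]_{\mathcal G}+[r,A\tilde r]_{\mathcal G}\big)-(\nabla_{\nu^*r}A)\tilde r+(\nabla_{\nu^*\tilde r}A)r+R(\nu^*r,\nu^*\tilde r)-2\nu\big(\langle i_{\nu^*r}R,\tilde r\rangle-\langle i_{\nu^*\tilde r}R,r\rangle+\langle(\nabla A)r,\tilde r\rangle\big)=0$; (10) $\nabla_{JX}(\nu\xi)-\nu\mathcal L_{JX}\xi-\nabla_{B\xi}(\mu X)-\mu\mathcal L_X(B\xi)+[\mu X,\nu\xi]_{\mathcal G}-\nu\big(i_{B\xi}i_XH-\mathcal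 L_X(J^*\xi)-2\langle i_XR,\nu\xi\rangle\big)-A\big(\nabla_X(\nu\xi)+R(X,B\xi)\big)+R(JX,B\xi)=0$.
   Context: $M$ is a connected smooth manifold. A quadratic Lie algebra bundle $(\mathcal G,[\cdot,\cdot]_{\mathcal G},\langle\cdot,\cdot\rangle_{\mathcal G})$ is a vector bundle over $M$ whose fibres are smoothly varying Lie algebras with ad-invariant scalar product (non-degenerate symmetric bilinear form). A standard Courant algebroid is $E=TM\oplus T^*M\oplus\mathcal G$ with data $(\nabla,R,H)$, where $\nabla$ is a connection on $\mathcal G$ preserving $[\cdot,\cdot]_{\mathcal G}$ and $\langle\cdot,\cdot\rangle_{\mathcal G}$, $R\in\Omega^2(M,\mathcal G)$, $H\in\Omega^3(M)$, $R^\nabla(X,Y)r=[R(X,Y),r]_{\mathcal G}$, $d^\nabla R=0$, $dH=\langle R\wedge R\rangle_{\mathcal G}$ ($\langle R\wedge R\rangle_{\mathcal G}(X,Y,Z,V)=2\sum_{\mathrm{cycl}(X,Y,Z)}\langle R(X,Y),R(Z,V)\rangle_{\mathcal G}$). Anchor: projection $\pi:E\to TM$. Scalar product: $\langle X+\xi+r,Y+\eta+\tilde r\rangle=\frac12(\eta(X)+\xi(Y))+\langle r,\tilde r\rangle_{\mathcal G}$. Dorfman bracket: $[X,Y]=\mathcal L_XY+i_Yi_XH+R(X,Y)$, $[X,r]=-2\langle i_XR,r\rangle+\nabla_Xr$, $[r_1,r_2]=2\langle\nabla r_1,r_2\rangle+[r_1,r_2]_{\mathcal G}$, $[X,\eta]=\mathcal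 L_X\eta$, $[\eta_1,\eta_2]=[r,\eta]=0$, together with $[u,v]+[v,u]=2d\langle u,v\rangle$. Unless otherwise stated Courant algebroids are of neutral signature. $\langle\cdot,\cdot\rangle$ also denotes $\langle\cdot,\cdot\rangle_{\mathcal G}$ on $\mathcal G$. A generalised almost complex structure is a skew-symmetric $\mathcal J\in\Gamma(\mathrm{End}\,E)$ with $\mathcal J^2=-\mathrm{Id}$; it is integrable if the sections of its $i$-eigenbundle in $E^{\mathbb C}$ are closed under the Dorfman bracket (equivalently its Nijenhuis tensor with respect to the Dorfman bracket vanishes). Its components are $J\in\Gamma(\mathrm{End}\,TM)$, $A\in\Gamma(\mathrm{End}\,\mathcal G)$, $B:T^*M\to TM$, $C:TM\to T^*M$, $\mu:TM\to\mathcal G$, $\nu:T^*M\to\mathcal G$, defined by $$\mathcal J X=JX+CX+\mu X,\quad \mathcal J\xi=B\xi-J^*\xi+\nu\xi,\quad \mathcal J r=-\nu^*r-\mu^*r+Ar .$$ Here $J^*:T^*M\to T^*M$ is the dual map and $\nu^*:\mathcal G\to TM$, $\mu^*:\mathcal G\to T^*M$ are adjoints for the scalar product of $E$: $\langle\nu^*r,\xi\rangle=\langle r,\nu\xi\rangle$ (i.e. $\xi(\nu^*r)=2\langle r,\nu\xi\rangle$), $\langle\mu^*r,X\rangle=\langle r,\mu X\rangle$ (i.e. $(\mu^*r)(X)=2\langle r,\mu X\rangle$). $B$ and $C$ are skew and also regarded as a bivector and a 2-form: $B(\xi,\eta)=\eta(B\xi)$, $C(X,Y)=(CX)(Y)$,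 $CX=i_XC$. Notation: $\mathcal L$ is the Lie derivative ($\mathcal L_XY$ is the Lie bracket of vector fields); $\langle i_XR,r\rangle$ is the 1-form $Y\mapsto\langle R(X,Y),r\rangle$; $\langle\nabla r,s\rangle$ is the 1-form $X\mapsto\langle\nabla_Xr,s\rangle$; $\langle(\nabla A)r,s\rangle$ is the 1-form $X\mapsto\langle(\nabla_XA)r,s\rangle$; $(\mathcal L_ZC)Y=i_Y\mathcal L_ZC$; $i_Yi_XH=H(X,Y,\cdot)$. *)

(* Defs.v *)
From HB Require Import structures.
From mathcomp Require Import all_boot all_order all_algebra.
From mathcomp Require Import boolp classical_sets functions reals.
From mathcomp Require Import topology normedtype landau derive.
From mathcomp Require Import ring.

Set Implicit Arguments.
Unset Strict Implicit.
Unset Printing Implicit Defensive.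

Import Order.TTheory GRing.Theory Num.Theory.
Import numFieldNormedType.Exports.

Local Open Scope classical_set_scope.
Local Open Scope ring_scope.

Section NearDifferentiable.
Context {K : realType} {V W : normedModType K}.

Lemma near0_differentiable (f : V -> W) x :
  (\forall y \near x, f y = 0) -> differentiable f x.
Proof.
move=> f0.
have f1 : \forall y \near 0, f (y + x) = 0.
  by move: f0; rewrite (near_shift 0); apply: filterS => y /=; rewrite subr0.
have E : f \o shift x = cst (f x) + (\0 : V -> W) +o_ 0 id.
  apply/eqaddoP => e e0; near=> y.
  rewrite !fctE /= (nbhs_singleton f0) addr0 subr0.
  suff -> : f (y + x) = 0 by rewrite normr0 mulr_ge0// ltW.
  by near: y; exact: f1.
have c0 : continuous (\0 : V -> W) by exact: cst_continuous.
have D := diff_unique c0 E.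
by apply/diff_locallyP; rewrite D; split.
Unshelve. all: by end_near. Qed.

Lemma near_eq_differentiable (f g : V -> W) x :
  (\forall y \near x, f y = g y) -> differentiable f x -> differentiable g x.
Proof.
move=> fg df; rewrite -[g](addrNK f); apply: differentiableD => //.
apply: near0_differentiable; apply: filterS fg => y fgy.
by rewrite !fctE fgy subrr.
Qed.

End NearDifferentiable.

Section Ck.
Context {K : realType} {V : normedModType K}.
Implicit Types (A : set V) (f g : V -> K).

(* Used only on open sets A; in finite dimension, asking that all directional
   derivatives be C^k amounts to asking that of the differential. *)
Fixpoint Ck (k : nat) A f : Prop :=
  match k with
  | 0 => forall x, A x -> {for x, continuous f}
  | k'.+1 => (forall x, A x -> differentiable f x) /\
             (forall v, Ck k' A (fun x => 'D_v f x))
  end.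

Definition Cinfty A f := forall k, Ck k A f.

Lemma open_near A f g : open A -> (forall x, A x -> f x = g x) ->
  forall x, A x -> \forall y \near x, f y = g y.
Proof.
move=> oA fg x Ax; have : nbhs x A by apply: open_nbhs_nbhs.
by apply: filterS => y /fg.
Qed.

Lemma Ck_eq k A f g : open A -> (forall x, A x -> f x = g x) ->
  Ck k A f -> Ck k A g.
Proof.
move=> oA; elim: k f g => [|k IH] f g fg /=.
  move=> Cf x Ax; rewrite /prop_for /continuous_at -(fg x Ax).
  apply: cvg_trans (Cf x Ax); apply: near_eq_cvg; exact: open_near oA fg x Ax.
move=> [df dDf]; split=> [x Ax|v].
  by apply: near_eq_differentiable (df x Ax); exact: open_near oA fg x Ax.
apply: IH (dDf v) => x Ax; apply: near_eq_derive; exact: open_near oA fg x Ax.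
Qed.

Lemma CkW k A f : open A -> Ck k.+1 A f -> Ck k A f.
Proof.
move=> oA; elim: k f => [|k IH] f [df Df] /=.
  by move=> x /df; exact: differentiable_continuous.
by split=> // v; apply: IH; exact: Df.
Qed.

Lemma CkD k A f g : open A -> Ck k A f -> Ck k A g -> Ck k A (f + g).
Proof.
move=> oA; elim: k f g => [|k IH] f g /=.
  by move=> Cf Cg x Ax; apply: continuousD; [exact: Cf|exact: Cg].
move=> [df Df] [dg Dg]; split=> [x Ax|v].
  by apply: differentiableD; [exact: df|exact: dg].
apply: Ck_eq (IH _ _ (Df v) (Dg v)) => // x Ax.
by rewrite deriveD//; apply: diff_derivable; [exact: df|exact: dg].
Qed.

Lemma CkM k A f g : open A -> Ck k A f -> Ck k A g -> Ck k A (f * g).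
Proof.
move=> oA; elim: k f g => [|k IH] f g.
  by move=> Cf Cg x Ax; apply: continuousM; [exact: Cf|exact: Cg].
move=> Cf Cg; have [Cf' Cg'] := (CkW oA Cf, CkW oA Cg).
case: Cf Cg => [df Df] [dg Dg]; split=> [x Ax|v].
  by apply: differentiableM; [exact: df|exact: dg].
apply: Ck_eq (CkD oA (IH _ _ Cf' (Dg v)) (IH _ _ Cg' (Df v))) => // x Ax.
by rewrite deriveM//; apply: diff_derivable; [exact: df|exact: dg].
Qed.

Lemma Ck_cst k A (c : K) : Ck k A (cst c).
Proof.
elim: k c => [|k IH] c /=; first by move=> x _; exact: cst_continuous.
split=> [x _|v]; first exact: differentiable_cst.
by rewrite (_ : (fun _ => _) = cst 0) //; apply/funext => x; rewrite derive_cst.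
Qed.

End Ck.

(* mchart a : mdom a -> mcod a is a homeomorphism with inverse mparam a; off
   mdom a and mcod a the values of these functions are irrelevant. *)
Record manifold (K : realType) := Manifold {
  mpoint :> topologicalType;
  mdim : nat;
  mchart_idx : Type;
  mdom : mchart_idx -> set mpoint;
  mcod : mchart_idx -> set 'rV[K]_mdim;
  mchart : mchart_idx -> mpoint -> 'rV[K]_mdim;
  mparam : mchart_idx -> 'rV[K]_mdim -> mpoint;
  m_hausdorff : hausdorff_space mpoint;
  m_second_countable : @second_countable mpoint;
  mdom_open : forall a, open (mdom a);
  mcod_open : forall a, open (mcod a);
  mdom_cover : forall x, exists a, mdom a x;
  mchart_cod : forall a x, mdom a x -> mcod a (mchart a x);
  mparam_dom : forall a y, mcod a y -> mdom a (mparam a y);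
  mchartK : forall a x, mdom a x -> mparam a (mchart a x) = x;
  mparamK : forall a y, mcod a y -> mchart a (mparam a y) = y;
  mchart_cont : forall a x, mdom a x -> {for x, continuous (mchart a)};
  mparam_cont : forall a y, mcod a y -> {for y, continuous (mparam a)};
  mtrans_smooth : forall a b i,
    Cinfty (mcod a `&` mparam a @^-1` mdom b)
           (fun y => mchart b (mparam a y) 0 i)
}.

Section SmoothFunctions.
Context {K : realType} (M : manifold K).
Implicit Types (U : set M) (f g : M -> K).

Definition smooth_on U f :=
  forall a, Cinfty (mcod a `&` mparam a @^-1` U) (f \o mparam a).

Lemma open_param (a : mchart_idx M) U : open U ->
  open (mcod a `&` mparam a @^-1` U).
Proof.
rewrite !openE => oU y [Ay Uy]; apply: filterI.
  by have := @mcod_open _ M a; rewrite openE; exact.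
exact: mparam_cont Ay _ (oU _ Uy).
Qed.

Lemma smooth_onD U f g : open U ->
  smooth_on U f -> smooth_on U g -> smooth_on U (f + g).
Proof. by move=> oU sf sg a k; apply: CkD (sf a k) (sg a k); exact: open_param. Qed.

Lemma smooth_onM U f g : open U ->
  smooth_on U f -> smooth_on U g -> smooth_on U (f * g).
Proof. by move=> oU sf sg a k; apply: CkM (sf a k) (sg a k); exact: open_param. Qed.

Lemma smooth_on_cst U (c : K) : smooth_on U (cst c).
Proof. by move=> a k; exact: Ck_cst. Qed.

Lemma smooth_onS U U' f : open U -> U `<=` U' -> smooth_on U' f -> smooth_on U f.
Proof.
move=> oU UU' sf a k; have := sf a k; move: (f \o mparam a) => {}f {sf}.
have : mcod a `&` mparam a @^-1` U `<=` mcod a `&` mparam a @^-1` U'.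
  by move=> y [Ay Uy]; split=> //; exact: UU'.
elim: k f => [|k IH] f sub /=; first by move=> h y /sub; exact: h.
move=> [df Df]; split=> [y /sub|v]; first exact: df.
exact: IH (Df v).
Qed.

Record smoothfun := SmoothFun {
  smoothfun_fun :> M -> K;
  smoothfunP : smooth_on setT smoothfun_fun
}.

Lemma smoothfun_eq (f g : smoothfun) : (forall x, f x = g x) -> f = g.
Proof.
case: f g => f sf [g sg] /= /funext fg; rewrite -fg in sg *.
by congr SmoothFun; exact: Prop_irrelevance.
Qed.

HB.instance Definition _ := gen_eqMixin smoothfun.
HB.instance Definition _ := gen_choiceMixin smoothfun.

Definition cstf (c : K) := SmoothFun (@smooth_on_cst setT c).
Definition sfun_add (f g : smoothfun) :=
  SmoothFun (smooth_onD openT (smoothfunP f) (smoothfunP g)).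
Definition sfun_mul (f g : smoothfun) :=
  SmoothFun (smooth_onM openT (smoothfunP f) (smoothfunP g)).
Definition sfun_opp (f : smoothfun) := sfun_mul (cstf (-1)) f.

Fact sfun_addfA : associative sfun_add.
Proof. by move=> f g h; apply: smoothfun_eq => x; exact: addrA. Qed.
Fact sfun_addfC : commutative sfun_add.
Proof. by move=> f g; apply: smoothfun_eq => x; exact: addrC. Qed.
Fact sfun_add0f : left_id (cstf 0) sfun_add.
Proof. by move=> f; apply: smoothfun_eq => x; exact: add0r. Qed.
Fact sfun_addNf : left_inverse (cstf 0) sfun_opp sfun_add.
Proof. by move=> f; apply: smoothfun_eq => x /=; rewrite !fctE mulN1r addNr. Qed.
HB.instance Definition _ := GRing.isZmodule.Build smoothfun
  sfun_addfA sfun_addfC sfun_add0f sfun_addNf.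

Fact sfun_mulfA : associative sfun_mul.
Proof. by move=> f g h; apply: smoothfun_eq => x; exact: mulrA. Qed.
Fact sfun_mulfC : commutative sfun_mul.
Proof. by move=> f g; apply: smoothfun_eq => x; exact: mulrC. Qed.
Fact sfun_mul1f : left_id (cstf 1) sfun_mul.
Proof. by move=> f; apply: smoothfun_eq => x; exact: mul1r. Qed.
Fact sfun_mulfDl : left_distributive sfun_mul sfun_add.
Proof. by move=> f g h; apply: smoothfun_eq => x; exact: mulrDl. Qed.
HB.instance Definition _ :=
  GRing.Zmodule_isComPzRing.Build smoothfun
    sfun_mulfA sfun_mulfC sfun_mul1f sfun_mulfDl.

End SmoothFunctions.

Section VectorFields.
Context {K : realType} (M : manifold K).
Local Notation C := (smoothfun M).

(* Vector fields are derivations of the K-algebra C = C^oo(M) of smooth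
   functions; differential forms, and more generally tensor fields, are
   C-multilinear maps between modules of sections. *)
Definition is_derivation (D : C -> C) :=
  [/\ forall f g, D (f + g) = D f + D g,
      forall c f, D (cstf M c * f) = cstf M c * D f
    & forall f g, D (f * g) = D f * g + f * D g].

Record vfield := VField {
  vfield_fun :> C -> C;
  vfieldP : is_derivation vfield_fun
}.

Lemma vfield_eq (X Y : vfield) : (forall f, X f = Y f) -> X = Y.
Proof.
case: X Y => X XP [Y YP] /= /funext XY.
by move: XP; rewrite XY => XP; congr VField; exact: Prop_irrelevance.
Qed.

Lemma vfieldD (X : vfield) f g : X (f + g) = X f + X g.
Proof. by case: (vfieldP X). Qed.
Lemma vfieldZ (X : vfield) c f : X (cstf M c * f) = cstf M c * X f.
Proof. by case: (vfieldP X). Qed.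
Lemma vfieldM (X : vfield) f g : X (f * g) = X f * g + f * X g.
Proof. by case: (vfieldP X). Qed.

HB.instance Definition _ := gen_eqMixin vfield.
HB.instance Definition _ := gen_choiceMixin vfield.

Fact vf0_subproof : is_derivation (fun=> 0).
Proof.
by split=> [f g|c f|f g]; rewrite ?addr0 ?mulr0 ?mul0r ?addr0.
Qed.
Fact vf_add_subproof (X Y : vfield) : is_derivation (fun f => X f + Y f).
Proof.
split=> [f g|c f|f g]; first by rewrite !vfieldD addrACA.
  by rewrite !vfieldZ mulrDr.
by rewrite !vfieldM mulrDl mulrDr addrACA.
Qed.
Fact vf_scale_subproof (h : C) (X : vfield) : is_derivation (fun f => h * X f).
Proof.
split=> [f g|c f|f g]; first by rewrite vfieldD mulrDr.
  by rewrite vfieldZ mulrCA.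
by rewrite vfieldM mulrDr mulrA mulrCA.
Qed.

Definition vf0 := VField vf0_subproof.
Definition vf_add X Y := VField (vf_add_subproof X Y).
Definition vf_scale h X := VField (vf_scale_subproof h X).
Definition vf_opp := vf_scale (-1).

Fact vf_addA : associative vf_add.
Proof. by move=> X Y Z; apply: vfield_eq => f; exact: addrA. Qed.
Fact vf_addC : commutative vf_add.
Proof. by move=> X Y; apply: vfield_eq => f; exact: addrC. Qed.
Fact vf_add0 : left_id vf0 vf_add.
Proof. by move=> X; apply: vfield_eq => f; exact: add0r. Qed.
Fact vf_addN : left_inverse vf0 vf_opp vf_add.
Proof. by move=> X; apply: vfield_eq => f /=; rewrite mulN1r addNr. Qed.
HB.instance Definition _ :=
  GRing.isZmodule.Build vfield vf_addA vf_addC vf_add0 vf_addN.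

Fact vf_scaleA g h (X : vfield) : vf_scale g (vf_scale h X) = vf_scale (g * h) X.
Proof. by apply: vfield_eq => f; exact: mulrA. Qed.
Fact vf_scale1 : left_id 1 vf_scale.
Proof. by move=> X; apply: vfield_eq => f; exact: mul1r. Qed.
Fact vf_scaleDr : right_distributive vf_scale +%R.
Proof. by move=> h X Y; apply: vfield_eq => f; exact: mulrDr. Qed.
Fact vf_scaleDl X : {morph vf_scale^~ X : g h / g + h}.
Proof. by move=> g h; apply: vfield_eq => f; exact: mulrDl. Qed.
HB.instance Definition _ := GRing.Zmodule_isLmodule.Build C vfield
  vf_scaleA vf_scale1 vf_scaleDr vf_scaleDl.

Lemma vfield_addE (X Y : vfield) f : (X + Y) f = X f + Y f. Proof. by []. Qed.
Lemma vfield_scaleE h (X : vfield) f : (h *: X) f = h * X f. Proof. by []. Qed.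
Lemma vfield0 (X : vfield) : X 0 = 0.
Proof. by apply: (addrI (X 0)); rewrite -vfieldD !addr0. Qed.
Lemma vfieldN (X : vfield) f : X (- f) = - X f.
Proof. by apply: (addrI (X f)); rewrite -vfieldD !subrr vfield0. Qed.
Lemma vfield_oppE (X : vfield) f : (- X) f = - X f.
Proof. by rewrite -[LHS]/(-1 * X f) mulN1r. Qed.

Fact lie_subproof (X Y : vfield) : is_derivation (fun f => X (Y f) - Y (X f)).
Proof.
split=> [f g|c f|f g].
- by rewrite !vfieldD opprD addrACA.
- by rewrite !vfieldZ mulrBr.
- rewrite !vfieldM !vfieldD !vfieldM; ring.
Qed.
Definition lie X Y := VField (lie_subproof X Y).

Lemma lieC X Y : lie X Y = - lie Y X.
Proof. by apply: vfield_eq => f; rewrite vfield_oppE /= opprB. Qed.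
Lemma lie_lin (h : C) (X X' Y : vfield) :
  lie (h *: X + X') Y = h *: lie X Y + lie X' Y - Y h *: X.
Proof.
apply: vfield_eq => f.
rewrite !vfield_addE vfield_oppE !vfield_scaleE /=.
rewrite vfieldD vfieldM; ring.
Qed.

Definition is_linear_form (w : vfield -> C) :=
  forall (h : C) (X Y : vfield), w (h *: X + Y) = h * w X + w Y.

Record oneform := OneForm {
  oneform_fun :> vfield -> C;
  oneformP : is_linear_form oneform_fun
}.

Lemma oneform_eq (w w' : oneform) : (forall X, w X = w' X) -> w = w'.
Proof.
case: w w' => w wP [w' wP'] /= /funext ww'.
by move: wP; rewrite ww' => wP; congr OneForm; exact: Prop_irrelevance.
Qed.

HB.instance Definition _ := gen_eqMixin oneform.
HB.instance Definition _ := gen_choiceMixin oneform.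

Fact of0_subproof : is_linear_form (fun=> 0).
Proof. by move=> h X Y; rewrite mulr0 addr0. Qed.
Fact of_add_subproof (w w' : oneform) : is_linear_form (fun X => w X + w' X).
Proof. by move=> h X Y; rewrite !oneformP mulrDr addrACA. Qed.
Fact of_scale_subproof (h : C) (w : oneform) : is_linear_form (fun X => h * w X).
Proof. by move=> g X Y; rewrite oneformP mulrDr mulrCA. Qed.

Definition of0 := OneForm of0_subproof.
Definition of_add w w' := OneForm (of_add_subproof w w').
Definition of_scale h w := OneForm (of_scale_subproof h w).
Definition of_opp := of_scale (-1).

Fact of_addA : associative of_add.
Proof. by move=> w w' w''; apply: oneform_eq => X; exact: addrA. Qed.
Fact of_addC : commutative of_add.
Proof. by move=> w w'; apply: oneform_eq => X; exact: addrC. Qed.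
Fact of_add0 : left_id of0 of_add.
Proof. by move=> w; apply: oneform_eq => X; exact: add0r. Qed.
Fact of_addN : left_inverse of0 of_opp of_add.
Proof. by move=> w; apply: oneform_eq => X /=; rewrite mulN1r addNr. Qed.
HB.instance Definition _ :=
  GRing.isZmodule.Build oneform of_addA of_addC of_add0 of_addN.

Fact of_scaleA g h (w : oneform) : of_scale g (of_scale h w) = of_scale (g * h) w.
Proof. by apply: oneform_eq => X; exact: mulrA. Qed.
Fact of_scale1 : left_id 1 of_scale.
Proof. by move=> w; apply: oneform_eq => X; exact: mul1r. Qed.
Fact of_scaleDr : right_distributive of_scale +%R.
Proof. by move=> h w w'; apply: oneform_eq => X; exact: mulrDr. Qed.
Fact of_scaleDl w : {morph of_scale^~ w : g h / g + h}.
Proof. by move=> g h; apply: oneform_eq => X; exact: mulrDl. Qed.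
HB.instance Definition _ := GRing.Zmodule_isLmodule.Build C oneform
  of_scaleA of_scale1 of_scaleDr of_scaleDl.

Lemma oneform_addE (w w' : oneform) X : (w + w') X = w X + w' X. Proof. by []. Qed.
Lemma oneform_scaleE h (w : oneform) X : (h *: w) X = h * w X. Proof. by []. Qed.
Lemma oneform_oppE (w : oneform) X : (- w) X = - w X.
Proof. by rewrite -[LHS]/(-1 * w X) mulN1r. Qed.
Lemma oneformD (w : oneform) X Y : w (X + Y) = w X + w Y.
Proof. by rewrite -[X in w (X + _)]scale1r oneformP mul1r. Qed.
Lemma oneform0 (w : oneform) : w 0 = 0.
Proof. by apply: (addrI (w 0)); rewrite -oneformD !addr0. Qed.
Lemma oneformZ (w : oneform) h X : w (h *: X) = h * w X.
Proof. by rewrite -[h *: X]addr0 oneformP oneform0 addr0. Qed.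
Lemma oneformN (w : oneform) X : w (- X) = - w X.
Proof. by rewrite -scaleN1r oneformZ mulN1r. Qed.

(* C-linearity in the remaining arguments follows from antisymmetry, which is
   the same as alternation since 2 is invertible. *)
Record form2 (W : lmodType C) := Form2 {
  form2_fun :> vfield -> vfield -> W;
  form2P : forall (h : C) (X X' Y : vfield),
    form2_fun (h *: X + X') Y = h *: form2_fun X Y + form2_fun X' Y;
  form2C : forall X Y, form2_fun X Y = - form2_fun Y X
}.

Record form3 := Form3 {
  form3_fun :> vfield -> vfield -> vfield -> C;
  form3P : forall (h : C) (X X' Y Z : vfield),
    form3_fun (h *: X + X') Y Z = h * form3_fun X Y Z + form3_fun X' Y Z;
  form3C12 : forall X Y Z, form3_fun X Y Z = - form3_fun Y X Z;
  form3C23 : forall X Y Z, form3_fun X Y Z = - form3_fun X Z Y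
}.

Fact dfun_subproof (f : C) : is_linear_form (fun X => X f).
Proof. by []. Qed.
Definition dfun f := OneForm (dfun_subproof f).

Fact lie1_subproof (X : vfield) (w : oneform) :
  is_linear_form (fun Y => X (w Y) - w (lie X Y)).
Proof.
move=> h Y Y'; rewrite oneformP vfieldD vfieldM (lieC X) lie_lin.
rewrite opprB opprD (lieC Y) (lieC Y') scalerN !opprK oneformD oneformZ.
rewrite oneformP; ring.
Qed.
(* L_X w *)
Definition lie1 X w := OneForm (lie1_subproof X w).

Lemma form2Dr (W : lmodType C) (w : form2 W) h X Y Y' :
  w X (h *: Y + Y') = h *: w X Y + w X Y'.
Proof. by rewrite form2C form2P opprD -scalerN -!(form2C w X). Qed.

Lemma form3_rot (H : form3) X Y Z : H X Y Z = H Z X Y.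
Proof. by rewrite form3C23 form3C12 opprK. Qed.

Fact contr3_subproof (H : form3) X Y : is_linear_form (H X Y).
Proof. by move=> h Z Z'; rewrite !(form3_rot H X Y) form3P. Qed.
(* [contr3 Y X H] is i_Y i_X H, the 1-form H(X, Y, .). *)
Definition contr3 Y X H := OneForm (contr3_subproof H X Y).

Definition d2_fun (w : form2 C^o) (X Y Z : vfield) : C :=
  X (w Y Z) - Y (w X Z) + Z (w X Y)
  - w (lie X Y) Z + w (lie X Z) Y - w (lie Y Z) X.

(* For scalar 2-forms, with values read in C instead of C^o. *)
Lemma form2Pl (w : form2 C^o) h X X' Y :
  w (h *: X + X') Y = h * w X Y + w X' Y :> C.
Proof. exact (form2P w h X X' Y). Qed.
Lemma form2Pr (w : form2 C^o) h X Y Y' :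
  w X (h *: Y + Y') = h * w X Y + w X Y' :> C.
Proof. exact (form2Dr w h X Y Y'). Qed.
Lemma form2Cc (w : form2 C^o) X Y : w X Y = - w Y X :> C.
Proof. exact (form2C w X Y). Qed.
Lemma form2Nl (w : form2 C^o) X Y : w (- X) Y = - w X Y :> C.
Proof.
have w0 : w 0 Y = 0 :> C.
  have := form2Pl w 1 0 0 Y; rewrite scaler0 addr0 mul1r.
  by move=> /(congr1 (fun t : C => t - w 0 Y)); rewrite subrr addrK.
by rewrite -[- X]scaleN1r -[-1 *: X]addr0 form2Pl w0 addr0 mulN1r.
Qed.

Fact d2_subproof1 w h X X' Y Z :
  d2_fun w (h *: X + X') Y Z = h * d2_fun w X Y Z + d2_fun w X' Y Z.
Proof.
rewrite /d2_fun !lie_lin ![_ + _ - (_ *: _)]addrC -!scaleNr !form2Pl form2Pr.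
rewrite vfield_addE vfield_scaleE !vfieldD !vfieldM.
ring.
Qed.
Fact d2_subproof2 w X Y Z : d2_fun w X Y Z = - d2_fun w Y X Z.
Proof.
rewrite /d2_fun (lieC Y X) form2Nl (form2Cc w Y X) vfieldN; ring.
Qed.
Fact d2_subproof3 w X Y Z : d2_fun w X Y Z = - d2_fun w X Z Y.
Proof.
rewrite /d2_fun (lieC Z Y) form2Nl (form2Cc w Z Y) vfieldN; ring.
Qed.
Definition d2 w := Form3 (d2_subproof1 w) (d2_subproof2 w) (d2_subproof3 w).

Fact lie2_subproof (Z : vfield) (w : form2 C^o) (Y : vfield) :
  is_linear_form (fun X => Z (w Y X : C) - w (lie Z Y) X - w Y (lie Z X)).
Proof.
move=> h X X'.
have E : lie Z (h *: X + X') = h *: lie Z X + (Z h *: X + lie Z X').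
  by rewrite !(lieC Z) lie_lin scalerN !opprD opprK [Z h *: X + _]addrC addrA.
by rewrite E !form2Pr vfieldD vfieldM; ring.
Qed.
(* [lie2 Z w Y] is the 1-form i_Y (L_Z w). *)
Definition lie2 Z w Y := OneForm (lie2_subproof Z w Y).

End VectorFields.

Section VectorBundles.
Context {K : realType} (M : manifold K).
Local Notation C := (smoothfun M).

(* A vector bundle is a family of vector spaces with local trivialisations
   (vtriv a x, with inverse vframe a x, for x in vdom a) whose transition
   functions are smooth; off vdom a, vtriv and vframe are irrelevant. *)
Record vbundle := VBundle {
  vfib :> M -> lmodType K;
  vrank : nat;
  vtriv_idx : Type;
  vdom : vtriv_idx -> set M;
  vtriv : forall (a : vtriv_idx) (x : M), {linear vfib x -> 'rV[K]_vrank};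
  vframe : forall (a : vtriv_idx) (x : M), {linear 'rV[K]_vrank -> vfib x};
  vdom_open : forall a, open (vdom a);
  vdom_cover : forall x, exists a, vdom a x;
  vtrivK : forall a x, vdom a x -> cancel (vtriv a x) (vframe a x);
  vframeK : forall a x, vdom a x -> cancel (vframe a x) (vtriv a x);
  vtrans_smooth : forall a b v i, smooth_on (vdom a `&` vdom b)
    (fun x => vtriv b x (vframe a x v) 0 i)
}.

Context (G : vbundle).

Definition smooth_section (s : forall x, G x) :=
  forall (a : vtriv_idx G) i, smooth_on (vdom a) (fun x => vtriv a x (s x) 0 i).

Record vsection := VSection {
  vsection_fun :> forall x, G x;
  vsectionP : smooth_section vsection_fun
}.

Lemma vsection_eq (s t : vsection) : (forall x, s x = t x) -> s = t.
Proof.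
case: s t => s sP [t tP] /= st.
have {st}st : s = t by exact: functional_extensionality_dep.
by move: sP; rewrite st => sP; congr VSection; exact: Prop_irrelevance.
Qed.

HB.instance Definition _ := gen_eqMixin vsection.
HB.instance Definition _ := gen_choiceMixin vsection.

Fact vs0_subproof : smooth_section (fun=> 0).
Proof.
move=> a i; rewrite (_ : (fun _ => _) = cst 0); first exact: smooth_on_cst.
by apply/funext => x; rewrite linear0 mxE.
Qed.
Fact vs_add_subproof (s t : vsection) : smooth_section (fun x => s x + t x).
Proof.
move=> a i.
rewrite (_ : (fun _ => _) = (fun x => vtriv a x (s x) 0 i) +
                            (fun x => vtriv a x (t x) 0 i)).
  by apply: smooth_onD; [exact: vdom_open|exact: vsectionP|exact: vsectionP].
by apply/funext => x; rewrite linearD mxE.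
Qed.
Fact vs_scale_subproof (f : C) (s : vsection) : smooth_section (fun x => f x *: s x).
Proof.
move=> a i.
rewrite (_ : (fun _ => _) = (f : M -> K) * (fun x => vtriv a x (s x) 0 i)).
  apply: smooth_onM; [exact: vdom_open| |exact: vsectionP].
  by apply: (@smooth_onS _ _ _ setT) (smoothfunP f) => //; exact: vdom_open.
by apply/funext => x; rewrite linearZ mxE.
Qed.

Definition vs0 := VSection vs0_subproof.
Definition vs_add s t := VSection (vs_add_subproof s t).
Definition vs_scale f s := VSection (vs_scale_subproof f s).
Definition vs_opp := vs_scale (-1).

Fact vs_addA : associative vs_add.
Proof. by move=> s t u; apply: vsection_eq => x; exact: addrA. Qed.
Fact vs_addC : commutative vs_add.
Proof. by move=> s t; apply: vsection_eq => x; exact: addrC. Qed.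
Fact vs_add0 : left_id vs0 vs_add.
Proof. by move=> s; apply: vsection_eq => x; exact: add0r. Qed.
Fact vs_addN : left_inverse vs0 vs_opp vs_add.
Proof.
move=> s; apply: vsection_eq => x /=.
by rewrite [X in X *: _](_ : _ = -1 * 1) ?mulr1 ?scaleN1r ?addNr.
Qed.
HB.instance Definition _ :=
  GRing.isZmodule.Build vsection vs_addA vs_addC vs_add0 vs_addN.

Fact vs_scaleA f g s : vs_scale f (vs_scale g s) = vs_scale (f * g) s.
Proof. by apply: vsection_eq => x; exact: scalerA. Qed.
Fact vs_scale1 : left_id 1 vs_scale.
Proof. by move=> s; apply: vsection_eq => x; exact: scale1r. Qed.
Fact vs_scaleDr : right_distributive vs_scale +%R.
Proof. by move=> f s t; apply: vsection_eq => x; exact: scalerDr. Qed.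
Fact vs_scaleDl s : {morph vs_scale^~ s : f g / f + g}.
Proof. by move=> f g; apply: vsection_eq => x; exact: scalerDl. Qed.
HB.instance Definition _ := GRing.Zmodule_isLmodule.Build C vsection
  vs_scaleA vs_scale1 vs_scaleDr vs_scaleDl.

End VectorBundles.

Record quadratic_lie_bundle (K : realType) (M : manifold K) := QuadraticLieBundle {
  qbundle :> vbundle M;
  qbr : forall x, qbundle x -> qbundle x -> qbundle x;
  qip : forall x, qbundle x -> qbundle x -> K;
  qbr_linear : forall x c (u u' v : qbundle x),
    qbr (c *: u + u') v = c *: qbr u v + qbr u' v;
  qbr_alt : forall x (u : qbundle x), qbr u u = 0;
  qbr_jacobi : forall x (u v w : qbundle x),
    qbr u (qbr v w) + qbr v (qbr w u) + qbr w (qbr u v) = 0;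
  qip_linear : forall x c (u u' v : qbundle x),
    qip (c *: u + u') v = c * qip u v + qip u' v;
  qip_sym : forall x (u v : qbundle x), qip u v = qip v u;
  qip_nondeg : forall x (u : qbundle x), (forall v, qip u v = 0) -> u = 0;
  qip_ad : forall x (u v w : qbundle x), qip (qbr u v) w + qip v (qbr u w) = 0;
  qbr_smooth : forall s t : vsection qbundle,
    smooth_section (fun x => qbr (s x) (t x));
  qip_smooth : forall s t : vsection qbundle,
    smooth_on setT (fun x => qip (s x) (t x))
}.

Section QuadraticLieBundle.
Context {K : realType} {M : manifold K} {G : quadratic_lie_bundle M}.
Local Notation C := (smoothfun M).
Implicit Types r s : vsection G.

Definition gbr r s := VSection (qbr_smooth r s).
Definition gip r s : C := SmoothFun (qip_smooth r s).

Lemma gipC r s : gip r s = gip s r.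
Proof. by apply: smoothfun_eq => x; exact: qip_sym. Qed.
Lemma gipP f r r' s : gip (f *: r + r') s = f * gip r s + gip r' s.
Proof. by apply: smoothfun_eq => x; exact: qip_linear. Qed.
Lemma gipDl r r' s : gip (r + r') s = gip r s + gip r' s.
Proof. by rewrite -[r]scale1r gipP mul1r scale1r. Qed.
Lemma gip0l s : gip 0 s = 0.
Proof. by apply: (addrI (gip 0 s)); rewrite -gipDl !addr0. Qed.
Lemma gipZl f r s : gip (f *: r) s = f * gip r s.
Proof. by rewrite -[f *: r]addr0 gipP gip0l addr0. Qed.
Lemma gipNl r s : gip (- r) s = - gip r s.
Proof. by rewrite -scaleN1r gipZl mulN1r. Qed.

End QuadraticLieBundle.

Section Courant.
Context {K : realType} {M : manifold K} (G : quadratic_lie_bundle M).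
Local Notation C := (smoothfun M).
Local Notation T := (vfield M).
Local Notation F := (oneform M).
Local Notation Gm := (vsection G).
Local Notation E := (vfield M * oneform M * vsection G)%type.

(* The last two fields read d^nabla R = 0 and dH = <R /\ R>, the exterior
   derivatives being expanded by Koszul's formula. *)
Record courant_data := CourantData {
  nabla : T -> Gm -> Gm;
  curv : form2 Gm;
  threeform : form3 M;
  nabla_linear : forall (h : C) (X Y : T) (r : Gm),
    nabla (h *: X + Y) r = h *: nabla X r + nabla Y r;
  nablaD : forall (X : T) (r s : Gm), nabla X (r + s) = nabla X r + nabla X s;
  nabla_leibniz : forall (X : T) (f : C) (r : Gm),
    nabla X (f *: r) = X f *: r + f *: nabla X r;
  nabla_gbr : forall (X : T) (r s : Gm),
    nabla X (gbr r s) = gbr (nabla X r) s + gbr r (nabla X s);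
  nabla_gip : forall (X : T) (r s : Gm),
    X (gip r s) = gip (nabla X r) s + gip r (nabla X s);
  curv_nabla : forall (X Y : T) (r : Gm),
    nabla X (nabla Y r) - nabla Y (nabla X r) - nabla (lie X Y) r
      = gbr (curv X Y) r;
  dnabla_curv : forall X Y Z : T,
    nabla X (curv Y Z) - nabla Y (curv X Z) + nabla Z (curv X Y)
      - curv (lie X Y) Z + curv (lie X Z) Y - curv (lie Y Z) X = 0;
  d_threeform : forall X Y Z V : T,
    let H := threeform in
    X (H Y Z V) - Y (H X Z V) + Z (H X Y V) - V (H X Y Z)
      - H (lie X Y) Z V + H (lie X Z) Y V - H (lie X V) Y Z
      - H (lie Y Z) X V + H (lie Y V) X Z - H (lie Z V) X Y
    = (gip (curv X Y) (curv Z V) + gip (curv Y Z) (curv X V)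
       + gip (curv Z X) (curv Y V)) *+ 2
}.

(* Sections of E = TM + T^*M + G are triples (X, xi, r). *)
Definition inT (X : T) : E := (X, 0, 0).
Definition inF (xi : F) : E := (0, xi, 0).
Definition inG (r : Gm) : E := (0, 0, r).

Definition eip (u v : E) : C :=
  cstf M 2^-1 * (v.1.2 u.1.1 + u.1.2 v.1.1) + gip u.2 v.2.

(* The pointwise values of sections of E at x form the fibre E_x, and, the
   scalar product being non-degenerate, vanishing at x means being orthogonal
   to all sections at x. The clauses say that E_x has an orthonormal basis
   made of m vectors of square 1 and m vectors of square -1. *)
Definition neutral_signature :=
  forall x : M, exists (m : nat) (e f : 'I_m -> E),
    [/\ forall i j, eip (e i) (e j) x = (i == j)%:R,
        forall i j, eip (f i) (f j) x = - (i == j)%:R,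
        forall i j, eip (e i) (f j) x = 0
      & forall w, (forall i, eip w (e i) x = 0) ->
                  (forall i, eip w (f i) x = 0) ->
                  forall w', eip w w' x = 0].

Record gacs := Gacs {
  gacs_fun :> {linear E -> E};
  gacs_skew : forall u v, eip (gacs_fun u) v = - eip u (gacs_fun v);
  gacs_sq : forall u, gacs_fun (gacs_fun u) = - u
}.

Section Dorfman.
Context (D : courant_data).

Fact icurv_subproof X r : is_linear_form (fun Y => gip (curv D X Y) r).
Proof. by move=> h Y Y'; rewrite form2Dr gipP. Qed.
(* <i_X R, r> *)
Definition icurv X r := OneForm (icurv_subproof X r).

Fact nablaip_subproof r s : is_linear_form (fun X => gip (nabla D X r) s).
Proof. by move=> h X X'; rewrite nabla_linear gipP. Qed.
(* <nabla r, s> *)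
Definition nablaip r s := OneForm (nablaip_subproof r s).

Definition nablaEnd (A : Gm -> Gm) X r := nabla D X (A r) - A (nabla D X r).

Fact nablaEndip_subproof (A : {linear Gm -> Gm}) r s :
  is_linear_form (fun X => gip (nablaEnd A X r) s).
Proof.
move=> h X X'; rewrite /nablaEnd !nabla_linear linearP opprD addrACA -scalerBr.
exact: gipP.
Qed.
(* <(nabla A) r, s> *)
Definition nablaEndip A r s := OneForm (nablaEndip_subproof A r s).

Definition dorf_TT X Y : E :=
  inT (lie X Y) + inF (contr3 Y X (threeform D)) + inG (curv D X Y).
Definition dorf_TF X eta : E := inF (lie1 X eta).
Definition dorf_TG X r : E := inF (- (icurv X r *+ 2)) + inG (nabla D X r).
Definition dorf_GG r s : E := inF (nablaip r s *+ 2) + inG (gbr r s).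

(* The brackets [xi, Y] and [r, Y] are given by [u,v] + [v,u] = 2 d<u,v>. *)
Definition dorfman (u v : E) : E :=
  let: (X, xi, r) := u in let: (Y, eta, s) := v in
  dorf_TT X Y + dorf_TF X eta + dorf_TG X s
  + (inF (dfun (eip (inF xi) (inT Y)) *+ 2) - dorf_TF Y xi)
  + (inF (dfun (eip (inG r) (inT Y)) *+ 2) - dorf_TG Y r)
  + dorf_GG r s.

(* Sections of the complexification of E: (a, b) stands for a + i b. *)
Definition cdorfman (w z : E * E) : E * E :=
  (dorfman w.1 z.1 - dorfman w.2 z.2, dorfman w.1 z.2 + dorfman w.2 z.1).
Definition mul_i (w : E * E) : E * E := (- w.2, w.1).

Definition eigenbundle_i (J : gacs) (w : E * E) := (J w.1, J w.2) = mul_i w.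

Definition gacs_integrable (J : gacs) :=
  forall w z, eigenbundle_i J w -> eigenbundle_i J z ->
              eigenbundle_i J (cdorfman w z).

End Dorfman.

Section Components.
Context (J : gacs).

(* J X = partJ X + partC X + partmu X, J xi = partB xi - dualJ xi + partnu xi
   and J r = - adjnu r - adjmu r + partA r (see J_inT, J_inF, J_inG). *)
Definition partJ X : T := (J (inT X)).1.1.
Definition partC X : F := (J (inT X)).1.2.
Definition partmu X : Gm := (J (inT X)).2.
Definition partB xi : T := (J (inF xi)).1.1.
Definition partnu xi : Gm := (J (inF xi)).2.
Definition partA r : Gm := (J (inG r)).2.

Lemma inT_linear : linear inT.
Proof.
move=> h X Y; rewrite /inT; transitivity ((h *: X + Y, h *: 0 + 0, h *: 0 + 0) : E) => //.
by rewrite !scaler0 !addr0.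
Qed.
Lemma inF_linear : linear inF.
Proof.
move=> h X Y; rewrite /inF; transitivity ((h *: 0 + 0, h *: X + Y, h *: 0 + 0) : E) => //.
by rewrite !scaler0 !addr0.
Qed.
Lemma inG_linear : linear inG.
Proof.
move=> h X Y; rewrite /inG; transitivity ((h *: 0 + 0, h *: 0 + 0, h *: X + Y) : E) => //.
by rewrite !scaler0 !addr0.
Qed.

Lemma partJ_linear : linear partJ.
Proof. by move=> h X Y; rewrite /partJ inT_linear linearP. Qed.
Lemma partC_linear : linear partC.
Proof. by move=> h X Y; rewrite /partC inT_linear linearP. Qed.
Lemma partmu_linear : linear partmu.
Proof. by move=> h X Y; rewrite /partmu inT_linear linearP. Qed.
Lemma partB_linear : linear partB.
Proof. by move=> h X Y; rewrite /partB inF_linear linearP. Qed.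
Lemma partnu_linear : linear partnu.
Proof. by move=> h X Y; rewrite /partnu inF_linear linearP. Qed.
Lemma partA_linear : linear partA.
Proof. by move=> h X Y; rewrite /partA inG_linear linearP. Qed.
HB.instance Definition _ := GRing.isLinear.Build C Gm Gm *:%R partA partA_linear.

Lemma half_inj (f g : C) : cstf M 2^-1 * f = cstf M 2^-1 * g -> f = g.
Proof.
move=> fg; apply: smoothfun_eq => x.
have /(congr1 (fun h : C => h x)) := fg.
by apply: mulfI; rewrite invr_eq0 pnatr_eq0.
Qed.
Lemma half2 (f : C) : cstf M 2^-1 * (f *+ 2) = f.
Proof.
apply: smoothfun_eq => x; rewrite mulr2n -[LHS]/(2^-1 * (f x + f x)).
by field.
Qed.

Lemma eipC (u v : E) : eip u v = eip v u.
Proof. by rewrite /eip gipC [v.1.2 _ + _]addrC. Qed.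
Lemma eip_inT u X : eip u (inT X) = cstf M 2^-1 * u.1.2 X.
Proof. by rewrite /eip /= gipC gip0l addr0 add0r. Qed.
Lemma eip_inF u xi : eip u (inF xi) = cstf M 2^-1 * xi u.1.1.
Proof. by rewrite /eip /= gipC gip0l addr0 oneform0 addr0. Qed.
Lemma eip_inG u r : eip u (inG r) = gip u.2 r.
Proof. by rewrite /eip /= oneform0 addr0 mulr0 add0r. Qed.

Fact partC2_subproof1 h X X' Y :
  partC (h *: X + X') Y = h *: (partC X Y : C^o) + partC X' Y :> C^o.
Proof. by rewrite partC_linear. Qed.
Fact partC2_subproof2 X Y : partC X Y = - (partC Y X : C^o) :> C^o.
Proof.
by apply: half_inj; rewrite mulrN -!eip_inT gacs_skew eipC eip_inT.
Qed.
Definition partC2 : form2 C^o := Form2 partC2_subproof1 partC2_subproof2.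

Definition partB2 (xi eta : F) : C := eta (partB xi).

Fact dualJ_subproof (xi : F) : is_linear_form (fun X => xi (partJ X)).
Proof. by move=> h X Y; rewrite partJ_linear oneformP. Qed.
Definition dualJ (xi : F) := OneForm (dualJ_subproof xi).

Fact adjmu_subproof r : is_linear_form (fun X => gip r (partmu X) *+ 2).
Proof.
by move=> h X Y; rewrite partmu_linear gipC gipP ![gip _ r]gipC mulrnDl mulrnAr.
Qed.
Definition adjmu r := OneForm (adjmu_subproof r).

Fact adjnu_subproof r : is_derivation (fun f => gip r (partnu (dfun f)) *+ 2).
Proof.
have D f g : dfun (f + g) = dfun f + dfun g :> F.
  by apply: oneform_eq => X; exact: vfieldD.
have Z c f : dfun (cstf M c * f) = cstf M c *: dfun f :> F.
  by apply: oneform_eq => X; exact: vfieldZ.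
have L f g : dfun (f * g) = g *: dfun f + f *: dfun g :> F.
  by apply: oneform_eq => X; rewrite /= vfieldM mulrC.
have nuD xi eta : partnu (xi + eta) = partnu xi + partnu eta.
  by rewrite -[xi]scale1r partnu_linear !scale1r.
have nu0 : partnu 0 = 0.
  by apply: (addrI (partnu 0)); rewrite -nuD !addr0.
have nuZ f xi : partnu (f *: xi) = f *: partnu xi.
  by rewrite -[f *: xi]addr0 partnu_linear nu0 addr0.
split=> [f g|c f|f g].
- by rewrite D nuD ![gip r _]gipC gipDl mulrnDl.
- by rewrite Z nuZ ![gip r _]gipC gipZl mulrnAr.
- by rewrite L nuD !nuZ ![gip r _]gipC gipDl !gipZl; ring.
Qed.
(* The vector field nu^* r, characterised by xi (nu^* r) = 2 <r, nu xi>
   (see adjnuP), is given by its action f |-> 2 <r, nu (df)> on functions. *)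
Definition adjnu r := VField (adjnu_subproof r).

Lemma J_inG r : J (inG r) = (- adjnu r, - adjmu r, partA r).
Proof.
have JF (xi : F) : xi (J (inG r)).1.1 = - (gip r (partnu xi) *+ 2).
  apply: half_inj; rewrite mulrN half2 -eip_inF gacs_skew eipC eip_inG.
  by rewrite gipC.
have JT X : (J (inG r)).1.2 X = - (gip r (partmu X) *+ 2).
  apply: half_inj; rewrite mulrN half2 -eip_inT gacs_skew eipC eip_inG.
  by rewrite gipC.
rewrite [LHS]surjective_pairing [(J _).1]surjective_pairing.
congr (_, _, _).
  by apply: vfield_eq => f; rewrite vfield_oppE; exact: (JF (dfun f)).
by apply: oneform_eq => X; rewrite oneform_oppE; exact: JT.
Qed.

Lemma adjnuP r (xi : F) : xi (adjnu r) = gip r (partnu xi) *+ 2.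
Proof.
apply: half_inj; rewrite half2; apply: oppr_inj.
rewrite [gip r _]gipC -eip_inG -(eipC (inG r)) -gacs_skew eip_inF J_inG.
by rewrite oneformN mulrN.
Qed.

Lemma J_inF xi : J (inF xi) = (partB xi, - dualJ xi, partnu xi).
Proof.
rewrite [LHS]surjective_pairing [(J _).1]surjective_pairing.
congr (_, _, _); apply: oneform_eq => X; rewrite oneform_oppE.
by apply: half_inj; rewrite mulrN -eip_inT gacs_skew eipC eip_inF.
Qed.

Lemma J_inT X : J (inT X) = (partJ X, partC X, partmu X).
Proof. by rewrite [LHS]surjective_pairing [(J _).1]surjective_pairing. Qed.

End Components.
End Courant.

(* Main.v *)
Require Import Defs.
From HB Require Import structures.
From mathcomp Require Import all_boot all_order all_algebra.
From mathcomp Require Import boolp classical_sets functions reals.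
From mathcomp Require Import topology normedtype sequences derive realfun exp.
From mathcomp Require Import ring.

(** Put N(u, v) = [J u, J v] - [u, v] - J ([J u, v] + [u, J v]), the Nijenhuis
    tensor of the generalised almost complex structure J for the Dorfman
    bracket. A section of the i-eigenbundle has the form u - i J u, and the
    bracket of two of them is again in the eigenbundle exactly when N vanishes
    on their real parts ([integrable_nijenhuis]).

    The Dorfman bracket satisfies
      pi(u) <v, w> = <[u, v], w> + <v, [u, w]>  and  [u, v] + [v, u] = 2 d<u, v>
    ([dorfman_invariant], [dorfman_sym]). As J is skew with square -1, it follows
    that (u, v, w) |-> <N(u, v), w> is totally skew-symmetric ([nijenhuisC],
    [nijenhuis_skew]). Splitting each argument along TM + T*M + G leaves ten
    independent components, one for each multiset of three summands. Each of
    the ten relations is the vanishing of one of them: the values of N on two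
    vector fields, on two 1-forms and on two sections of G have three components
    each, and the last one is the G-component of N(X, xi) ([nijenhuis_TT],
    [nijenhuis_FF], [nijenhuis_GG], [nijenhuis_TF_G]). Their computation needs
    only Cartan's formula for the 2-form C. The eight remaining components of N
    are paired with test sections and moved to the known ones by skew-symmetry
    ([nijenhuis_eq0]).

    This last step needs that a section of G orthogonal to all sections is zero
    ([gip_nondeg]). Since the scalar product is given fibrewise, one needs enough
    global sections, hence smooth bump functions. They are built in a chart as
    products of flat functions of the coordinates ([exists_bump]); a local frame
    multiplied by a bump function extends by zero to a global section
    ([exists_section]). *)

Set Implicit Arguments.
Unset Strict Implicit.
Unset Printing Implicit Defensive.

Import Order.TTheory GRing.Theory Num.Theory.
Import numFieldNormedType.Exports.

Local Open Scope classical_set_scope.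
Local Open Scope ring_scope.

(** * Flat functions *)

Section FlatFunctions.
Context {K : realType}.
Implicit Types (n : nat) (t : K).

(** The powers of [t^-1] make the family stable under derivation up to linear
    combinations, so that smoothness follows from differentiability. *)
Definition flat n t : K := if 0 < t then t^-1 ^+ n * expR (- t^-1) else 0.

Lemma flatSl n t : flat n t = flat n.+1 t * t.
Proof.
rewrite /flat; case: ifPn => [t0|_]; last by rewrite mul0r.
by rewrite exprS [RHS]mulrC !mulrA divff ?mul1r// gt_eqF.
Qed.

(** With [u = t^-1] this is [u ^+ n.+1 <= n.+1`! * expR u]. *)
Lemma flat_le n t : `|flat n t| <= n.+1`!%:R * `|t|.
Proof.
rewrite /flat; case: ifPn => [t0|_]; last by rewrite normr0 mulr_ge0.
have u0 : 0 < t^-1 by rewrite invr_gt0.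
rewrite [`|t|]gtr0_norm// ger0_norm; last first.
  by rewrite mulr_ge0 ?expR_ge0// exprn_ge0// ltW.
rewrite -[t in leRHS]invrK.
rewrite expRN ler_pdivlMr// mulrAC -exprSr ler_pdivrMr ?expR_gt0//.
have := expR_ge1Dxn n (ltW u0).
rewrite -ler_pdivrMl ?ltr0n ?fact_gt0// mulrC => /(le_trans _); apply.
by rewrite lerDr.
Qed.

Lemma is_derive_flat n t :
  is_derive t 1 (flat n) (flat n.+2 t - n%:R * flat n.+1 t).
Proof.
have [t0|t0|->] := ltgtP t 0.
- have E m : flat m t = 0 by rewrite /flat ltNge (ltW t0).
  rewrite !E mulr0 subr0.
  have : is_derive t 1 (cst 0 : K -> K) 0 by exact: is_derive_cst.
  apply: near_eq_is_derive.
  near=> s; rewrite /flat ifF//; apply/negbTE; rewrite -leNgt ltW//.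
  by near: s; exact: lt_nbhsl.
- have tN0 : t != 0 by rewrite gt_eqF.
  have D : is_derive t 1 (fun s : K => s^-1 ^+ n * expR (- s^-1))
      (flat n.+2 t - n%:R * flat n.+1 t).
    have DV := @is_deriveV K id t 1 1 tN0 (is_derive_id _ _).
    have DX := is_deriveX n DV.
    have DE := @is_derive1_comp K expR _ t _ _ (is_derive_expR _) (is_deriveN DV).
    have -> : (fun s : K => s^-1 ^+ n * expR (- s^-1)) =
        (fun s => s^-1) ^+ n * (expR \o - (fun s => s^-1)).
      by apply/funext => s; rewrite !fctE.
    apply: (is_derive_eq (is_deriveM DX DE)).
    rewrite /flat t0 /= /GRing.scale /= !fctE mulr1.
    case: n {DX} => [|n]; rewrite ?expr0 ?mulr0n ?exprS /=; first by field.
    rewrite -mulr_natl; move: (t^-1 ^+ n) (expR (- t^-1)) => a b; by field.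
  move: D; apply: near_eq_is_derive.
  near=> s; rewrite /flat ifT//.
  by near: s; exact: lt_nbhsr.
- have E m : flat m 0 = 0 by rewrite /flat ltxx.
  (* By flatSl, the slope of flat n at 0 is the continuous function
     flat n.+1 *)
  apply/is_derive1_caratheodory; exists (flat n.+1); split.
  + by move=> s; rewrite E !subr0 flatSl.
  + rewrite /prop_for /continuous_at E.
    apply/cvgr0Pnorm_le => e e0; near=> s.
    apply: le_trans (flat_le _ _) _.
    rewrite -ler_pdivlMl ?ltr0n ?fact_gt0//.
    near: s; apply: (@cvgr0_norm_le _ _ _ _ _ id) => //.
    by rewrite mulr_gt0// invr_gt0 ltr0n fact_gt0.
  + by rewrite !E mulr0 subr0.
Unshelve. all: by end_near. Qed.

End FlatFunctions.

Section CkFlat.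
Context {K : realType} {V : normedModType K}.
Implicit Types (A B : set V) (f : V -> K).

(** The chain rule brings in [flat n.+1] and [flat n.+2], whence an induction on
    [k] for all [n] at once. *)
Lemma Ck_flat k n A f : open A -> Ck k A f -> Ck k A (flat n \o f).
Proof.
have dflat m t : differentiable (@flat K m) t.
  by apply/derivable1_diffP; case: (is_derive_flat m t).
move=> oA; elim: k n f => [|k IH] n f.
  move=> Cf x Ax; apply: continuous_comp; first exact: Cf.
  exact: differentiable_continuous.
move=> Cf; have Cf' := CkW oA Cf; case: Cf => df Df.
split=> [x Ax|v]; first by apply: differentiable_comp; [exact: df|].
have CF := CkD oA (IH n.+2 f Cf') (CkM oA (Ck_cst k A (- n%:R)) (IH n.+1 f Cf')).
apply: Ck_eq (CkM oA CF (Df v)) => // x Ax.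
have dfx := df x Ax.
rewrite !deriveE//; last exact: differentiable_comp.
rewrite diff_comp//= -[X in 'd (flat n) _ X]mulr1 -[_ * 1]/(_ *: 1) linearZ /=.
have [_] := is_derive_flat n (f x); rewrite deriveE// => ->.
by rewrite !fctE mulNr deriveE// mulrC.
Qed.

Lemma CkU k A B f : Ck k A f -> Ck k B f -> Ck k (A `|` B) f.
Proof.
elim: k f => [|k IH] f /= => [cA cB x [/cA|/cB]//|[dA DA] [dB DB]].
by split=> [x [/dA|/dB]//|v]; exact: IH.
Qed.

End CkFlat.

(** * Bump functions and global sections *)

Section Bump.
Context {K : realType} {M : manifold K}.
Implicit Types (U : set M) (f g : M -> K).

Lemma smooth_on_eq U f g : open U -> (forall x, U x -> f x = g x) ->
  smooth_on U f -> smooth_on U g.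
Proof.
move=> oU fg sf a k; apply: Ck_eq (sf a k); first exact: open_param.
by move=> y [_ Uy]; exact: fg.
Qed.

Lemma smooth_onU U U' f : smooth_on U f -> smooth_on U' f ->
  smooth_on (U `|` U') f.
Proof.
move=> sU sU' a k.
by rewrite preimage_setU setIUr; apply: CkU; [exact: sU|exact: sU'].
Qed.

Lemma smooth_on_chart (a : mchart_idx M) i :
  smooth_on (mdom a) (fun x => mchart a x 0 i).
Proof. by move=> b; exact: mtrans_smooth. Qed.

Lemma smooth_on_flat U f n : open U -> smooth_on U f ->
  smooth_on U (flat n \o f).
Proof. by move=> oU sf a k; apply: Ck_flat; [exact: open_param|exact: sf]. Qed.

Lemma smooth_on_prod U (I : Type) (s : seq I) (F : I -> M -> K) : open U ->
  (forall i, smooth_on U (F i)) -> smooth_on U (fun x => \prod_(i <- s) F i x).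
Proof.
move=> oU sF; elim: s => [|i s IH].
  by apply: smooth_on_eq (smooth_on_cst U 1) => // x _; rewrite big_nil.
apply: smooth_on_eq (smooth_onM oU (sF i) IH) => // x _.
by rewrite big_cons.
Qed.

Definition closed_box n (c : 'rV[K]_n) (e : K) : set 'rV[K]_n :=
  [set y | forall i, `|y 0 i - c 0 i| <= e].

Lemma closed_box_compact n (c : 'rV[K]_n) e : compact (closed_box c e).
Proof.
have -> : closed_box c e =
    [set y | forall i, `[c 0 i - e, c 0 i + e]%classic (y 0 i)].
  by apply/seteqP; split=> y /= h i; have := h i; rewrite in_itv/= ler_distl.
apply: (@rV_compact K _ (fun i => `[c 0 i - e, c 0 i + e]%classic)) => i.
exact: segment_compact.
Qed.

Lemma closed_box_sub n (c : 'rV[K]_n) (A : set 'rV[K]_n) : open A -> A c ->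
  exists2 e, 0 < e & closed_box c e `<=` A.
Proof.
move=> oA Ac; have /nbhs_ballP[e /= e0 eA] : nbhs c A by exact: open_nbhs_nbhs.
exists (e / 2); first by rewrite divr_gt0.
move=> y cy; apply: eA; split=> // i j; rewrite ord1 /ball /= distrC.
by apply: le_lt_trans (cy j) _; rewrite ltr_pdivrMr// ltr_pMr// ltr1n.
Qed.

(** The bump function is a product of flat functions of the coordinates, which
    vanishes outside a compact box of the chart. The box has a compact image in
    [M], closed because [M] is Hausdorff: this makes the extension by zero
    smooth. *)
Lemma exists_bump U x : open U -> U x ->
  exists (f : M -> K) (S : set M),
    [/\ smooth_on setT f, f x != 0, closed S, S `<=` U &
        forall y, ~ S y -> f y = 0].
Proof.
move=> oU Ux; have [a ax] := mdom_cover x.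
pose c := mchart a x.
have [] := @closed_box_sub _ c _ (open_param (a := a) oU).
  by split; [exact: mchart_cod|rewrite /= mchartK].
move=> e e0 eU.
pose beta (y : 'rV[K]_(mdim M)) : K :=
  \prod_i flat 0 (e ^+ 2 - (y 0 i - c 0 i) ^+ 2).
pose f y := if `[< mdom a y >] then beta (mchart a y) else 0.
pose S := mparam a @` closed_box c e.
have cS : closed S.
  apply: (compact_closed (@m_hausdorff _ M)).
  apply: continuous_compact (@closed_box_compact _ c e).
  apply: continuous_in_subspaceT => y; rewrite inE => /eU[+ _].
  exact: mparam_cont.
have f0 y : ~ S y -> f y = 0.
  move=> Sy; rewrite /f; case: asboolP => // ay.
  have /existsNP[i] : ~ closed_box c e (mchart a y).
    by move=> h; apply: Sy; exists (mchart a y) => //; rewrite mchartK.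
  move=> /negP; rewrite -ltNge => yi; rewrite /beta (bigD1 i)//= /flat.
  rewrite ifF ?mul0r//.
  apply/negbTE; rewrite -leNgt subr_le0 -[leRHS]real_normK ?num_real//.
  by rewrite ler_sqr ?nnegrE// ?ltW.
exists f, S; split=> //; last by move=> _ [y /eU[_ Uy] <-].
- rewrite (_ : setT = mdom a `|` ~` S); last first.
    apply/seteqP; split=> // y _; case: (pselect (S y)) => [|Sy]; last by right.
    by move=> [z /eU[az _] <-]; left; exact: mparam_dom.
  apply: smooth_onU.
    have oa := @mdom_open _ M a.
    have h : smooth_on (mdom a) (fun y => beta (mchart a y)).
      apply: smooth_on_prod => // i; apply: smooth_on_flat => //.
      have s1 := smooth_onD oa (smooth_on_chart a i) (smooth_on_cst _ (- c 0 i)).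
      have s2 := smooth_onM oa (smooth_on_cst _ (-1)) (smooth_onM oa s1 s1).
      apply: smooth_on_eq (smooth_onD oa (smooth_on_cst _ (e ^+ 2)) s2) => //.
      by move=> y _; rewrite !fctE mulN1r -expr2.
    by apply: smooth_on_eq h => // y ay; rewrite /f asboolT.
  apply: smooth_on_eq (smooth_on_cst _ 0); first exact: closed_openC.
  by move=> y /f0.
- rewrite /f asboolT// /beta; apply/prodf_neq0 => i _.
  by rewrite subrr expr0n subr0 /flat exprn_gt0// expr0 mul1r gt_eqF// expR_gt0.
Qed.

End Bump.

Section GlobalSections.
Context {K : realType} {M : manifold K}.

(** The factor [c] is the value of an unnormalised bump function at [x]. *)
Lemma exists_section (G : vbundle M) (x : M) (v : G x) :
  exists s : vsection G, exists2 c : K, c != 0 & s x = c *: v.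
Proof.
have [a ax] := @vdom_cover _ _ G x.
have [f [S [sf fx cS Sa f0]]] := exists_bump (@vdom_open _ _ G a) ax.
pose w := vtriv a x v.
have sP : smooth_section (fun y => f y *: @vframe _ _ G a y w).
  move=> b i.
  have ob := @vdom_open _ _ G b; have oa := @vdom_open _ _ G a.
  rewrite (_ : vdom b = (vdom a `&` vdom b) `|` (vdom b `&` ~` S)); last first.
    apply/seteqP; split=> y; last by case=> -[].
    move=> yb; case: (pselect (S y)) => [/Sa ya|Sy]; [by left|by right].
  apply: smooth_onU.
    have oab := openI oa ob.
    have sfab := smooth_onS oab (@subsetT _ _) sf.
    have h := smooth_onM oab sfab (vtrans_smooth a b w i).
    by apply: smooth_on_eq h => // y _; rewrite linearZ mxE.
  apply: smooth_on_eq (smooth_on_cst _ 0).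
    by apply: openI => //; exact: closed_openC.
  by move=> y [_ /f0 ->]; rewrite scale0r linear0 mxE.
by exists (VSection sP), (f x) => //=; rewrite vtrivK.
Qed.

Lemma gip_nondeg (G : quadratic_lie_bundle M) (r : vsection G) :
  (forall s, gip r s = 0) -> r = 0.
Proof.
move=> r0; apply: vsection_eq => x; apply: qip_nondeg => v.
have [s [c c0 sx]] := @exists_section G x v.
have q0 : qip (0 : G x) (r x) = 0.
  by rewrite -(addNr v) -scaleN1r qip_linear mulN1r addNr.
have /(congr1 (fun h : smoothfun M => h x)) := r0 s.
rewrite /= sx qip_sym -[c *: v]addr0 qip_linear q0 addr0 qip_sym.
by move=> /eqP; rewrite mulf_eq0 (negbTE c0) => /eqP.
Qed.

(** Reduces identities between sections to identities in the ring of functions,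
    where they can be decided by normalisation. *)
Lemma gip_ext (G : quadratic_lie_bundle M) (r s : vsection G) :
  (forall t, gip r t = gip s t) -> r = s.
Proof.
move=> rs; apply/eqP; rewrite -subr_eq0; apply/eqP/gip_nondeg => t.
by rewrite gipDl gipNl rs subrr.
Qed.

End GlobalSections.

(** * Additivity of the tensors and brackets *)

Section AdditiveMaps.
Context {U V : zmodType} (f : U -> V).
Context (fD : {morph f : x y / x + y}).

Lemma morphD0 : f 0 = 0.
Proof. by apply: (addrI (f 0)); rewrite -fD !addr0. Qed.

Lemma morphDN x : f (- x) = - f x.
Proof. by apply: (addrI (f x)); rewrite -fD !subrr morphD0. Qed.

End AdditiveMaps.

Section Tensors.
Context {K : realType} {M : manifold K} {G : quadratic_lie_bundle M}.
Context (D : courant_data G).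
Local Notation C := (smoothfun M).
Implicit Types (f g : C) (X Y Z : vfield M) (r s t : vsection G).

Lemma smoothfun_mulr2n_inj f g : f *+ 2 = g *+ 2 -> f = g.
Proof. by move=> fg; rewrite -[f]half2 fg half2. Qed.

Lemma vfieldMn X f n : X (f *+ n) = X f *+ n.
Proof.
elim: n => [|n IH]; first exact: vfield0.
by rewrite !mulrS vfieldD IH.
Qed.

Lemma vfield_mulrnE X f n : (X *+ n) f = X f *+ n.
Proof.
elim: n => [|n IH]; first by [].
by rewrite !mulrS vfield_addE IH.
Qed.

Lemma lieDl X X' Y : lie (X + X') Y = lie X Y + lie X' Y.
Proof. by apply: vfield_eq => f; rewrite /= vfieldD opprD addrACA. Qed.
Lemma lieDr X Y Y' : lie X (Y + Y') = lie X Y + lie X Y'.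
Proof. by rewrite !(lieC X) lieDl opprD. Qed.
Lemma lie0l X : lie 0 X = 0.
Proof. exact: (morphD0 (fun Y Z => lieDl Y Z X)). Qed.
Lemma lie0r X : lie X 0 = 0.
Proof. exact: (morphD0 (lieDr X)). Qed.
Lemma lieNl X Y : lie (- X) Y = - lie X Y.
Proof. exact: (morphDN (fun Z Z' => lieDl Z Z' Y)). Qed.
Lemma lieNr X Y : lie X (- Y) = - lie X Y.
Proof. exact: (morphDN (lieDr X)). Qed.

Lemma dfun0 : dfun 0 = 0 :> oneform M.
Proof. by apply: oneform_eq => X; exact: vfield0. Qed.
Lemma dfunN f : dfun (- f) = - dfun f :> oneform M.
Proof. by apply: oneform_eq => X; rewrite oneform_oppE; exact: vfieldN. Qed.

Lemma form2_addl (W : lmodType C) (w : form2 W) X X' Y :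
  w (X + X') Y = w X Y + w X' Y.
Proof. by have := form2P w 1 X X' Y; rewrite !scale1r. Qed.
Lemma form2_addr (W : lmodType C) (w : form2 W) X Y Y' :
  w X (Y + Y') = w X Y + w X Y'.
Proof. by have := form2Dr w 1 X Y Y'; rewrite !scale1r. Qed.
Lemma form2_0l (W : lmodType C) (w : form2 W) Y : w 0 Y = 0.
Proof. exact: (morphD0 (fun X X' => form2_addl w X X' Y)). Qed.
Lemma form2_0r (W : lmodType C) (w : form2 W) X : w X 0 = 0.
Proof. exact: (morphD0 (form2_addr w X)). Qed.
Lemma form2_oppl (W : lmodType C) (w : form2 W) X Y : w (- X) Y = - w X Y.
Proof. exact: (morphDN (fun X X' => form2_addl w X X' Y)). Qed.
Lemma form2_oppr (W : lmodType C) (w : form2 W) X Y : w X (- Y) = - w X Y.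
Proof. exact: (morphDN (form2_addr w X)). Qed.

Lemma form3_addl (w : form3 M) X X' Y Z : w (X + X') Y Z = w X Y Z + w X' Y Z.
Proof. by have := form3P w 1 X X' Y Z; rewrite scale1r mul1r. Qed.
Lemma form3_addm (w : form3 M) X Y Y' Z : w X (Y + Y') Z = w X Y Z + w X Y' Z.
Proof. by rewrite !(form3C12 w X) form3_addl opprD. Qed.
Lemma form3_0l (w : form3 M) Y Z : w 0 Y Z = 0.
Proof. exact: (morphD0 (fun X X' => form3_addl w X X' Y Z)). Qed.
Lemma form3_0m (w : form3 M) X Z : w X 0 Z = 0.
Proof. exact: (morphD0 (fun Y Y' => form3_addm w X Y Y' Z)). Qed.
Lemma form3_oppl (w : form3 M) X Y Z : w (- X) Y Z = - w X Y Z.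
Proof. exact: (morphDN (fun X X' => form3_addl w X X' Y Z)). Qed.
Lemma form3_oppm (w : form3 M) X Y Z : w X (- Y) Z = - w X Y Z.
Proof. exact: (morphDN (fun Y Y' => form3_addm w X Y Y' Z)). Qed.

Lemma gipDr r s t : gip r (s + t) = gip r s + gip r t.
Proof. by rewrite gipC gipDl !(gipC r). Qed.
Lemma gip0r r : gip r 0 = 0.
Proof. exact: (morphD0 (gipDr r)). Qed.
Lemma gipNr r s : gip r (- s) = - gip r s.
Proof. exact: (morphDN (gipDr r)). Qed.
Lemma gip_mulrnl r s n : gip (r *+ n) s = gip r s *+ n.
Proof.
elim: n => [|n IH]; first exact: gip0l.
by rewrite !mulrS gipDl IH.
Qed.

Lemma gip_ad r s t : gip (gbr r s) t = - gip s (gbr r t).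
Proof.
apply/eqP; rewrite -addr_eq0; apply/eqP.
by apply: smoothfun_eq => x; exact: qip_ad.
Qed.

Lemma gbrDl r r' s : gbr (r + r') s = gbr r s + gbr r' s.
Proof.
apply: vsection_eq => x /=.
by have := qbr_linear 1 (r x) (r' x) (s x); rewrite !scale1r.
Qed.

(** The bracket of the fibres is given to be linear in its first argument only;
    ad-invariance and non-degeneracy transfer this to the second one. *)
Lemma gbrDr r s s' : gbr r (s + s') = gbr r s + gbr r s'.
Proof. by apply: gip_ext => t; rewrite gipDl !gip_ad gipDl opprD. Qed.
Lemma gbr0l r : gbr 0 r = 0.
Proof. exact: (morphD0 (fun s t => gbrDl s t r)). Qed.
Lemma gbr0r r : gbr r 0 = 0.
Proof. exact: (morphD0 (gbrDr r)). Qed.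

Lemma gbrrr r : gbr r r = 0.
Proof. by apply: vsection_eq => x; exact: qbr_alt. Qed.

Lemma gbrC r s : gbr r s = - gbr s r.
Proof.
apply/eqP; rewrite -addr_eq0; apply/eqP.
by have := gbrrr (r + s); rewrite gbrDl !gbrDr !gbrrr add0r addr0.
Qed.

Lemma nablaDl X Y r : nabla D (X + Y) r = nabla D X r + nabla D Y r.
Proof. by have := nabla_linear D 1 X Y r; rewrite !scale1r. Qed.
Lemma nabla0l r : nabla D 0 r = 0.
Proof. exact: (morphD0 (fun X Y => nablaDl X Y r)). Qed.
Lemma nabla0r X : nabla D X 0 = 0.
Proof. exact: (morphD0 (nablaD D X)). Qed.
Lemma nablaNl X r : nabla D (- X) r = - nabla D X r.
Proof. exact: (morphDN (fun X Y => nablaDl X Y r)). Qed.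

Lemma curvC X Y : curv D X Y = - curv D Y X.
Proof. exact: form2C. Qed.

End Tensors.

(** * The scalar product and the Dorfman bracket *)

Section ScalarProduct.
Context {K : realType} {M : manifold K} {G : quadratic_lie_bundle M}.
Local Notation E := (vfield M * oneform M * vsection G)%type.
Implicit Types u v w : E.

Lemma E_ext u v :
  u.1.1 = v.1.1 -> (forall Z, u.1.2 Z = v.1.2 Z) -> u.2 = v.2 -> u = v.
Proof. by case: u v => [[X xi] r] [[Y eta] s] /= -> /oneform_eq -> ->. Qed.

Lemma E_decomp u : u = inT G u.1.1 + inF G u.1.2 + inG u.2.
Proof.
by case: u => [[X xi] r]; apply: E_ext => [|Z|] /=; rewrite ?addr0 ?add0r.
Qed.

Lemma addE_T u v : (u + v).1.1 = u.1.1 + v.1.1. Proof. by []. Qed.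
Lemma addE_F u v Z : (u + v).1.2 Z = u.1.2 Z + v.1.2 Z. Proof. by []. Qed.
Lemma addE_G u v : (u + v).2 = u.2 + v.2. Proof. by []. Qed.

(** Doubling removes the coefficient 1/2, so that identities between scalar
    products become identities with integer coefficients. *)
Lemma eip_mulr2n u v :
  eip u v *+ 2 = v.1.2 u.1.1 + u.1.2 v.1.1 + gip u.2 v.2 *+ 2.
Proof. by rewrite /eip mulrnDl -mulrnAr half2. Qed.

Lemma eipDl u u' v : eip (u + u') v = eip u v + eip u' v.
Proof.
apply: smoothfun_mulr2n_inj; rewrite [RHS]mulrnDl !eip_mulr2n /=.
rewrite oneformD gipDl; ring.
Qed.
Lemma eipNl u v : eip (- u) v = - eip u v.
Proof. exact: (morphDN (fun u u' => eipDl u u' v)). Qed.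
Lemma eipNr u v : eip u (- v) = - eip u v.
Proof. by rewrite eipC eipNl eipC. Qed.

(** A vector field is determined by the forms [dfun f], which already give its
    action on functions. *)
Lemma eip_nondeg u :
  (forall Z, eip u (inT G Z) = 0) -> (forall xi, eip u (inF G xi) = 0) ->
  (forall r, eip u (inG r) = 0) -> u = 0.
Proof.
move=> uT uF uG; apply: E_ext => [|Z|].
- apply: vfield_eq => f; apply: half_inj.
  by have := uF (dfun f); rewrite eip_inF => ->; rewrite mulr0.
- by apply: half_inj; have := uT Z; rewrite eip_inT => ->; rewrite mulr0.
- by apply: gip_nondeg => r; rewrite -eip_inG.
Qed.

End ScalarProduct.

Section Dorfman.
Context {K : realType} {M : manifold K} {G : quadratic_lie_bundle M}.
Context (D : courant_data G).
Local Notation E := (vfield M * oneform M * vsection G)%type.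
Implicit Types u v w : E.

Lemma dorfmanT u v : (dorfman D u v).1.1 = lie u.1.1 v.1.1.
Proof.
case: u v => [[X xi] r] [[Y eta] s] /=.
by rewrite !(addr0, subr0).
Qed.

Lemma dorfmanF u v Z : (dorfman D u v).1.2 Z =
  threeform D u.1.1 v.1.1 Z + (u.1.1 (v.1.2 Z) - v.1.2 (lie u.1.1 Z))
  - gip (curv D u.1.1 Z) v.2 *+ 2 + Z (u.1.2 v.1.1)
  - (v.1.1 (u.1.2 Z) - u.1.2 (lie v.1.1 Z))
  + gip (curv D v.1.1 Z) u.2 *+ 2 + gip (nabla D Z u.2) v.2 *+ 2.
Proof.
case: u v => [[X xi] r] [[Y eta] s] /=.
have E1 : Z (eip (inF G xi) (inT G Y)) + Z (eip (inF G xi) (inT G Y)) =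
    Z (xi Y).
  by rewrite -vfieldD -mulr2n eip_mulr2n /= gip0l mul0rn addr0 add0r.
have E2 : Z (eip (inG r) (inT G Y)) + Z (eip (inG r) (inT G Y)) = 0.
  by rewrite -vfieldD -mulr2n eip_mulr2n /= gipC gip0l mul0rn !addr0 vfield0.
rewrite E1 E2; ring.
Qed.

Lemma dorfmanG u v : (dorfman D u v).2 =
  curv D u.1.1 v.1.1 + nabla D u.1.1 v.2 - nabla D v.1.1 u.2 + gbr u.2 v.2.
Proof.
case: u v => [[X xi] r] [[Y eta] s] /=.
by rewrite !add0r !addr0 subr0 ?add0r ?sub0r.
Qed.

#[local] Arguments dorfman : simpl never.

Lemma dorfmanDl u u' v : dorfman D (u + u') v = dorfman D u v + dorfman D u' v.
Proof.
apply: E_ext => [|Z|].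
- by rewrite dorfmanT /= !dorfmanT lieDl.
- rewrite dorfmanF /= !dorfmanF.
  rewrite !(form3_addl, form2_addl, vfieldD, oneformD,
    lieDl, nablaD, gipDl, gipDr).
  ring.
- rewrite dorfmanG /= !dorfmanG form2_addl nablaDl nablaD gbrDl.
  apply: gip_ext => t; rewrite !(gipDl, gipNl, opprD); ring.
Qed.

Lemma dorfmanDr u v v' : dorfman D u (v + v') = dorfman D u v + dorfman D u v'.
Proof.
apply: E_ext => [|Z|].
- by rewrite dorfmanT /= !dorfmanT lieDr.
- rewrite dorfmanF /= !dorfmanF.
  rewrite !(form3_addm, form2_addl, vfieldD, oneformD,
    lieDl, nablaD, gipDl, gipDr).
  ring.
- rewrite dorfmanG /= !dorfmanG form2_addr nablaDl nablaD gbrDr.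
  apply: gip_ext => t; rewrite !(gipDl, gipNl, opprD); ring.
Qed.

Lemma dorfmanNl u v : dorfman D (- u) v = - dorfman D u v.
Proof. exact: (morphDN (fun u u' => dorfmanDl u u' v)). Qed.
Lemma dorfmanNr u v : dorfman D u (- v) = - dorfman D u v.
Proof. exact: (morphDN (dorfmanDr u)). Qed.

(** Metric connection, ad-invariant bracket on G, skew curvature and 3-form:
    together they say that [dorfman D u] acts on E by infinitesimal isometries
    above the vector field [u.1.1]. *)
Lemma dorfman_invariant u v w :
  u.1.1 (eip v w) = eip (dorfman D u v) w + eip v (dorfman D u w).
Proof.
apply: smoothfun_mulr2n_inj; rewrite mulrnDl (eipC v) -vfieldMn !eip_mulr2n.
rewrite !dorfmanF !dorfmanT !dorfmanG.
case: u v w => [[X xi] r] [[Y eta] s] [[Z zeta] t] /=.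
rewrite !(form3C23 _ X Z) (form2C _ Z Y) (lieC Z Y) oneformN gipNl.
rewrite !vfieldD (nabla_gip D) !(gipC s).
rewrite !(gipDl, gipNl) (gip_ad r s t) (gipC s (gbr r t)) !(gipC t).
ring.
Qed.

Lemma dorfman_sym u v :
  dorfman D u v + dorfman D v u = inF G (dfun (eip u v *+ 2)).
Proof.
apply: E_ext => [|Z|].
- by rewrite /= !dorfmanT lieC addNr.
- rewrite /= eip_mulr2n !dorfmanF.
  case: u v => [[X xi] r] [[Y eta] s] /=.
  rewrite (form3C12 _ Y X) !vfieldD (nabla_gip D) (gipC r (nabla D Z s)).
  ring.
- rewrite /= !dorfmanG.
  case: u v => [[X xi] r] [[Y eta] s] /=.
  rewrite (form2C _ Y X) (gbrC s); apply: gip_ext => t.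
  rewrite gip0l !(gipDl, gipNl); ring.
Qed.

End Dorfman.

#[local] Arguments dorfman : simpl never.

(** * The Nijenhuis tensor *)

Section Nijenhuis.
Context {K : realType} {M : manifold K} {G : quadratic_lie_bundle M}.
Context (D : courant_data G) (J : gacs G).
Local Notation E := (vfield M * oneform M * vsection G)%type.
Implicit Types u v w : E.

Definition nijenhuis u v : E :=
  dorfman D (J u) (J v) - dorfman D u v
  - J (dorfman D (J u) v + dorfman D u (J v)).

Lemma nijenhuisDl u u' v :
  nijenhuis (u + u') v = nijenhuis u v + nijenhuis u' v.
Proof.
rewrite /nijenhuis (linearD (gacs_fun J) u) !dorfmanDl.
rewrite (addrACA (dorfman D (J u) v)) (linearD (gacs_fun J)) !opprD.
by rewrite [RHS]addrACA [in RHS](addrACA (dorfman D (J u) (J v))).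
Qed.

(** The symmetric part of the bracket is exact, and the differentials cancel
    because [J] preserves the scalar product. *)
Lemma nijenhuisC u v : nijenhuis u v = - nijenhuis v u.
Proof.
have dN f : inF G (dfun (- f *+ 2)) + inF G (dfun (f *+ 2)) = 0.
  by apply: E_ext => [|Z|]; rewrite /= ?addr0// mulNrn vfieldN addNr.
apply/eqP; rewrite -addr_eq0; apply/eqP.
rewrite /nijenhuis addrACA [X in X + _]addrACA -!opprD -(linearD (gacs_fun J)).
rewrite (addrC (dorfman D (J v) u)) addrACA !dorfman_sym.
by rewrite !gacs_skew gacs_sq eipNr opprK subrr dN linear0 subr0.
Qed.

Lemma nijenhuisDr u v v' :
  nijenhuis u (v + v') = nijenhuis u v + nijenhuis u v'.
Proof. by rewrite !(nijenhuisC u) nijenhuisDl opprD. Qed.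

(** Each of the four brackets is moved across the scalar product by invariance;
    the derivatives of scalar products left over cancel because [J] is skew with
    square -1. *)
Lemma nijenhuis_skew u v w : eip (nijenhuis u v) w = - eip (nijenhuis u w) v.
Proof.
apply/eqP; rewrite -addr_eq0; apply/eqP.
rewrite /nijenhuis !(eipDl, eipNl) !gacs_skew !eipDl.
have I a b c : eip (dorfman D a b) c = a.1.1 (eip b c) - eip (dorfman D a c) b.
  by rewrite (dorfman_invariant D a b c) (eipC b) addrK.
rewrite (I (J u) (J v) w) (I u v w) (I (J u) v (J w)) (I u (J v) (J w)).
rewrite !(gacs_skew J v) gacs_sq eipNr !opprK vfieldN; ring.
Qed.

(** For [w = u - i J u] and [z = v - i J v], the imaginary part of the
    eigenbundle equation for the bracket of [w] and [z] reads
    [nijenhuis u v = 0], and the real part is its image under [J]. *)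
Lemma integrable_nijenhuis :
  gacs_integrable D J <-> forall u v, nijenhuis u v = 0.
Proof.
split=> [int u v|N0 [a b] [c d] /=].
  have Ew a : eigenbundle_i J (a, - J a).
    by rewrite /eigenbundle_i /mul_i /= opprK linearN gacs_sq opprK.
  have := int _ _ (Ew u) (Ew v); rewrite /eigenbundle_i /mul_i /= => -[_].
  rewrite !(dorfmanNl, dorfmanNr) opprK -opprD linearN => E1.
  rewrite /nijenhuis (addrC (dorfman D (J u) v)).
  by rewrite E1 addrA subrK subrr.
rewrite /eigenbundle_i /mul_i /= => -[Ja _] [Jc _].
have {}Ja : b = - J a by rewrite Ja opprK.
have {}Jc : d = - J c by rewrite Jc opprK.
have := N0 a c; rewrite /nijenhuis => /eqP; rewrite subr_eq0 => /eqP E1.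
rewrite Ja Jc !(dorfmanNl, dorfmanNr) opprK -opprD opprK.
rewrite (addrC (dorfman D a (J c))) linearN -E1 opprB; congr (_, _).
by rewrite -opprB linearN E1 gacs_sq opprK.
Qed.

(** By total skew-symmetry every [eip (nijenhuis u v) w] with arguments in the
    three summands is, up to sign, one whose first two arguments are as in the
    hypotheses. *)
Lemma nijenhuis_eq0 :
  (forall X Y, nijenhuis (inT G X) (inT G Y) = 0) ->
  (forall xi eta, nijenhuis (inF G xi) (inF G eta) = 0) ->
  (forall r s, nijenhuis (inG r) (inG s) = 0) ->
  (forall X xi, (nijenhuis (inT G X) (inF G xi)).2 = 0) ->
  forall u v, nijenhuis u v = 0.
Proof.
move=> TT FF GG TFG.
have e0 w : eip 0 w = 0 by exact: (morphD0 (fun u u' => eipDl u u' w)).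
have TF X xi : nijenhuis (inT G X) (inF G xi) = 0.
  apply: eip_nondeg => [Z|eta|r].
  - by rewrite nijenhuis_skew TT e0 oppr0.
  - by rewrite nijenhuisC eipNl nijenhuis_skew FF e0 !oppr0.
  - by rewrite eip_inG TFG gip0l.
have TG X r : nijenhuis (inT G X) (inG r) = 0.
  apply: eip_nondeg => [Z|eta|s].
  - by rewrite nijenhuis_skew TT e0 oppr0.
  - by rewrite nijenhuis_skew TF e0 oppr0.
  - by rewrite nijenhuisC eipNl nijenhuis_skew GG e0 !oppr0.
have FG xi r : nijenhuis (inF G xi) (inG r) = 0.
  apply: eip_nondeg => [Z|eta|s].
  - by rewrite nijenhuis_skew nijenhuisC TF oppr0 e0 oppr0.
  - by rewrite nijenhuis_skew FF e0 oppr0.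
  - by rewrite nijenhuisC eipNl nijenhuis_skew GG e0 !oppr0.
move=> u v; rewrite (E_decomp u) (E_decomp v) !(nijenhuisDl, nijenhuisDr).
rewrite (nijenhuisC (inF G _) (inT G _)) (nijenhuisC (inG _) (inT G _)).
rewrite (nijenhuisC (inG _) (inF G _)).
by rewrite !(TT, TF, TG, FF, FG, GG) !oppr0 !addr0.
Qed.

End Nijenhuis.

(** * Components of the Nijenhuis tensor *)

Section Components.
Context {K : realType} {M : manifold K} {G : quadratic_lie_bundle M}.
Context (D : courant_data G) (JJ : gacs G).
Local Notation C := (smoothfun M).
Local Notation T := (vfield M).
Local Notation F := (oneform M).
Local Notation Gm := (vsection G).
Local Notation E := (vfield M * oneform M * vsection G)%type.
Implicit Types (f : C) (u v w : E) (X Y Z : T) (r s t : Gm) (xi eta : F).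
Local Notation J := (partJ JJ).
Local Notation Jd := (dualJ JJ).
Local Notation A := (partA JJ).
Local Notation B := (partB JJ).
Local Notation B2 := (partB2 JJ).
Local Notation Cp := (partC JJ).
Local Notation C2 := (partC2 JJ).
Local Notation mu := (partmu JJ).
Local Notation mus := (adjmu JJ).
Local Notation nu := (partnu JJ).
Local Notation nus := (adjnu JJ).
Local Notation R := (curv D).
Local Notation H := (threeform D).
Local Notation nab := (nabla D).
Local Notation nij := (nijenhuis D JJ).
Local Notation mixed u v := (dorfman D (JJ u) v + dorfman D u (JJ v)).

HB.instance Definition _ := GRing.isLinear.Build C T T *:%R J (partJ_linear JJ).
HB.instance Definition _ :=
  GRing.isLinear.Build C T F *:%R Cp (partC_linear JJ).
HB.instance Definition _ :=
  GRing.isLinear.Build C T Gm *:%R mu (partmu_linear JJ).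
HB.instance Definition _ := GRing.isLinear.Build C F T *:%R B (partB_linear JJ).
HB.instance Definition _ :=
  GRing.isLinear.Build C F Gm *:%R nu (partnu_linear JJ).

Lemma gacsE u : JJ u =
  (J u.1.1 + B u.1.2 - nus u.2, Cp u.1.1 - Jd u.1.2 - mus u.2,
   mu u.1.1 + nu u.1.2 + A u.2).
Proof. by rewrite {1}(E_decomp u) !linearD J_inT J_inF J_inG. Qed.

Lemma partA_skew r s : gip (A r) s = - gip r (A s).
Proof.
have := gacs_skew JJ (inG r) (inG s).
by rewrite (eipC (inG r)) !eip_inG (gipC _ r).
Qed.
Lemma partB_skew xi eta : eta (B xi) = - xi (B eta).
Proof.
apply: half_inj; rewrite mulrN -[B xi]/(JJ (inF G xi)).1.1 -eip_inF.
by rewrite gacs_skew eipC eip_inF.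
Qed.
Lemma partC_skew X Y : Cp X Y = - Cp Y X.
Proof. exact: partC2_subproof2. Qed.

(* The additivity of the components at their own types, where rewriting does
   not have to search for a linear structure *)
Lemma partJ0 : J 0 = 0.
Proof. exact: linear0. Qed.
Lemma partC0 : Cp 0 = 0.
Proof. exact: linear0. Qed.
Lemma partmu0 : mu 0 = 0.
Proof. exact: linear0. Qed.
Lemma partnu0 : nu 0 = 0.
Proof. exact: linear0. Qed.
Lemma partA0 : A 0 = 0.
Proof. exact: linear0. Qed.
Lemma adjnu0 : nus 0 = 0.
Proof. by apply: vfield_eq => f; rewrite /= gip0l mul0rn. Qed.
Lemma partmuN X : mu (- X) = - mu X.
Proof. exact: linearN. Qed.
Lemma partnuN xi : nu (- xi) = - nu xi.
Proof. exact: linearN. Qed.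
Lemma partnuD xi eta : nu (xi + eta) = nu xi + nu eta.
Proof. exact: linearD. Qed.
Lemma partBB xi eta : B (xi - eta) = B xi - B eta.
Proof. exact: linearB. Qed.
Lemma partAD r s : A (r + s) = A r + A s.
Proof. exact: linearD. Qed.
Lemma partAN r : A (- r) = - A r.
Proof. exact: linearN. Qed.
Lemma partCN X Z : Cp (- X) Z = - Cp X Z.
Proof. by rewrite linearN oneform_oppE. Qed.
Lemma partCB X Y Z : Cp (X - Y) Z = Cp X Z - Cp Y Z.
Proof. by rewrite linearB oneform_addE oneform_oppE. Qed.

Local Notation zeroE := (adjnu0, partA0, partC0, partmu0, partnu0, partJ0,
  dfun0, mulr0, lie0l, lie0r, form3_0l, form3_0m, form2_0l, form2_0r, gbr0l, gbr0r,
  gip0r, gip0l, nabla0r D, nabla0l D, oneform0, vfield0, mul0rn, oppr0,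
  addr0, add0r, subr0).
Local Notation negE := (lieNl, lieNr, form3_oppl, form3_oppm, form2_oppl,
  form2_oppr, gipNl, gipNr, nablaNl D, oneformN, vfieldN, mulNrn).

(** The 1-form component is rearranged by Cartan's formula
    [L_X (C Y) - L_Y (C X) + d (C (X, Y)) = i_Y i_X dC + C (L_X Y)]. *)
Lemma mixed_TT X Y : mixed (inT G X) (inT G Y) =
  (lie X (J Y) - lie Y (J X),
   - (contr3 X (J Y) H + contr3 (J X) Y H + contr3 X Y (d2 C2) - Cp (lie X Y))
   - (icurv D X (mu Y) - icurv D Y (mu X)) *+ 2,
   R X (J Y) - R Y (J X) + nab X (mu Y) - nab Y (mu X)).
Proof.
rewrite !J_inT.
apply: E_ext => [|Z|]; [rewrite addE_T|rewrite addE_F|rewrite addE_G].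
- by rewrite !dorfmanT /= addrC (lieC (J X)).
- rewrite !dorfmanF /= !zeroE.
  rewrite /d2_fun /= !(form3C12 _ _ X) (form3C12 _ _ Y).
  rewrite (lieC Y X) !linearN /=.
  rewrite (partC_skew Y X) (partC_skew (lie Y Z)) (partC_skew (lie X Z)) vfieldN.
  ring.
- rewrite !dorfmanG /= !zeroE (curvC D (J X)); apply: gip_ext => t.
  rewrite !(gipDl, gipNl); ring.
Qed.

Lemma mixed_FF xi eta : mixed (inF G xi) (inF G eta) =
  (0, lie1 (B xi) eta - lie1 (B eta) xi - dfun (B2 xi eta), 0).
Proof.
rewrite !J_inF.
apply: E_ext => [|Z|]; [rewrite addE_T|rewrite addE_F|rewrite addE_G].
- by rewrite !dorfmanT /= !zeroE.
- rewrite !dorfmanF /= !zeroE /partB2 (partB_skew eta) vfieldN.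
  ring.
- by rewrite !dorfmanG /= !zeroE.
Qed.

Lemma mixed_GG r s : mixed (inG r) (inG s) =
  (0, (icurv D (nus r) s - icurv D (nus s) r + nablaEndip D A r s) *+ 2,
   gbr (A r) s + gbr r (A s) - nab (nus r) s + nab (nus s) r).
Proof.
rewrite !J_inG.
apply: E_ext => [|Z|]; [rewrite addE_T|rewrite addE_F|rewrite addE_G].
- by rewrite !dorfmanT /= !zeroE.
- rewrite !dorfmanF /= !(zeroE, negE) /nablaEnd gipDl gipNl partA_skew.
  ring.
- rewrite !dorfmanG /= !(zeroE, negE); apply: gip_ext => t.
  rewrite !(gipDl, gipNl); ring.
Qed.

Lemma mixed_TF X xi : mixed (inT G X) (inF G xi) =
  (lie X (B xi),
   lie1 (J X) xi + contr3 (B xi) X H - lie1 X (Jd xi) - icurv D X (nu xi) *+ 2,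
   nab X (nu xi) + R X (B xi)).
Proof.
rewrite !J_inF !J_inT.
apply: E_ext => [|Z|]; [rewrite addE_T|rewrite addE_F|rewrite addE_G].
- by rewrite !dorfmanT /= !zeroE.
- rewrite !dorfmanF /= !(zeroE, mulN1r, vfieldN); ring.
- rewrite !dorfmanG /= !zeroE; exact: addrC.
Qed.

Lemma nijenhuisT u v p : mixed u v = p -> (nij u v).1.1 =
  lie (JJ u).1.1 (JJ v).1.1 - lie u.1.1 v.1.1
  - (J p.1.1 + B p.1.2 - nus p.2).
Proof. by move=> Pp; rewrite /nijenhuis Pp (gacsE p) -!(dorfmanT D). Qed.

Lemma nijenhuisF u v p Z : mixed u v = p -> (nij u v).1.2 Z =
  (dorfman D (JJ u) (JJ v)).1.2 Z - (dorfman D u v).1.2 Z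
  - (Cp p.1.1 Z - p.1.2 (J Z) - gip p.2 (mu Z) *+ 2).
Proof.
move=> Pp; rewrite /nijenhuis Pp (gacsE p) addE_F addE_F.
by rewrite !oneform_oppE !oneform_addE !oneform_oppE.
Qed.

Lemma nijenhuisG u v p : mixed u v = p -> (nij u v).2 =
  (dorfman D (JJ u) (JJ v)).2 - (dorfman D u v).2
  - (mu p.1.1 + nu p.1.2 + A p.2).
Proof. by move=> Pp; rewrite /nijenhuis Pp (gacsE p). Qed.

Lemma nijenhuis_TT X Y : nij (inT G X) (inT G Y) =
  (lie (J X) (J Y) - lie X Y - J (lie X (J Y)) + J (lie Y (J X))
     + B (contr3 X (J Y) H + contr3 (J X) Y H + contr3 X Y (d2 C2)
          - Cp (lie X Y))
     + B (icurv D X (mu Y) - icurv D Y (mu X)) *+ 2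
     + nus (R X (J Y) - R Y (J X) + nab X (mu Y) - nab Y (mu X)),
   contr3 (J Y) (J X) H - contr3 Y X H
     + Jd (contr3 (J Y) X H - contr3 (J X) Y H)
     + icurv D (J Y) (mu X) *+ 2 - icurv D (J X) (mu Y) *+ 2
     - Jd (icurv D X (mu Y) - icurv D Y (mu X)) *+ 2
     + lie2 (J X) C2 Y - lie2 (J Y) C2 X + dfun (C2 X (J Y))
     + Jd (contr3 Y X (d2 C2) + Cp (lie X Y))
     + nablaip D (mu X) (mu Y) *+ 2
     + mus (R X (J Y) + R (J X) Y + nab X (mu Y) - nab Y (mu X)),
   R (J X) (J Y) - R X Y + nab (J X) (mu Y) - nab (J Y) (mu X)
     + gbr (mu X) (mu Y) - mu (lie X (J Y) - lie Y (J X))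
     + nu (contr3 X (J Y) H + contr3 (J X) Y H + contr3 X Y (d2 C2)
           - Cp (lie X Y))
     + nu (icurv D X (mu Y) - icurv D Y (mu X)) *+ 2
     - A (R X (J Y) - R Y (J X) + nab X (mu Y) - nab Y (mu X))).
Proof.
have p := mixed_TT X Y.
apply: E_ext => [|Z|];
  rewrite (nijenhuisT p, nijenhuisF _ p, nijenhuisG p) !J_inT.
- rewrite /=.
  have -> : J (lie X (J Y) - lie Y (J X)) = J (lie X (J Y)) - J (lie Y (J X)).
    exact: linearB.
  have -> xi eta : B (- xi - eta *+ 2) = - B xi - B eta *+ 2.
    by rewrite linearB linearN linearMn.
  apply: vfield_eq => f.
  rewrite !(vfield_addE, vfield_oppE, vfield_mulrnE).
  ring.
- rewrite !dorfmanF /= !zeroE partCB (d2_subproof2 _ Y) (form3C12 _ (J Y)).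
  rewrite (lieC (J X) Y) (lieC (J Y) X) !partCN (curvC D (J X) Y).
  rewrite !(gipDl, gipNl).
  ring.
- rewrite !dorfmanG /= !zeroE.
  have -> xi eta : nu (- xi - eta *+ 2) = - nu xi - nu eta *+ 2.
    by rewrite linearB linearN linearMn.
  apply: gip_ext => t.
  rewrite !(gipDl, gipNl, gip_mulrnl).
  ring.
Qed.

Lemma nijenhuis_FF xi eta : nij (inF G xi) (inF G eta) =
  (lie (B xi) (B eta) - B (lie1 (B xi) eta - lie1 (B eta) xi)
     + B (dfun (B2 xi eta)),
   lie1 (B eta) (Jd xi) - lie1 (B xi) (Jd eta) + dfun (B2 (Jd xi) eta)
     + Jd (lie1 (B xi) eta - lie1 (B eta) xi - dfun (B2 xi eta))
     - (icurv D (B xi) (nu eta) - icurv D (B eta) (nu xi)) *+ 2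
     + nablaip D (nu xi) (nu eta) *+ 2
     + contr3 (B eta) (B xi) H,
   R (B xi) (B eta) + nab (B xi) (nu eta) - nab (B eta) (nu xi)
     + gbr (nu xi) (nu eta)
     - nu (lie1 (B xi) eta - lie1 (B eta) xi - dfun (B2 xi eta))).
Proof.
have p := mixed_FF xi eta.
apply: E_ext => [|Z|];
  rewrite (nijenhuisT p, nijenhuisF _ p, nijenhuisG p) !J_inF.
- by rewrite /= !zeroE partBB opprB [_ - B _]addrC addrA.
- rewrite !dorfmanF /= !zeroE /partB2 (partB_skew (Jd xi)) /=.
  rewrite !mulN1r !vfieldN; ring.
- by rewrite !dorfmanG /= !zeroE.
Qed.

Lemma nijenhuis_GG r s : nij (inG r) (inG s) =
  (lie (nus r) (nus s)
     - B (icurv D (nus r) s - icurv D (nus s) r + nablaEndip D A r s) *+ 2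
     + nus (gbr (A r) s - gbr (A s) r - nab (nus r) s + nab (nus s) r),
   contr3 (nus s) (nus r) H + lie1 (nus r) (mus s) - lie1 (nus s) (mus r)
     + dfun (eip (inF G (mus r)) (inT G (nus s))) *+ 2
     + (icurv D (nus r) (A s) - icurv D (nus s) (A r)
        + nablaip D (A r) (A s) - nablaip D r s) *+ 2
     + Jd (icurv D (nus r) s - icurv D (nus s) r + nablaEndip D A r s) *+ 2
     + mus (gbr (A r) s + gbr r (A s) - nab (nus r) s + nab (nus s) r),
   gbr (A r) (A s) - gbr r s - A (gbr (A r) s + gbr r (A s))
     - nablaEnd D A (nus r) s + nablaEnd D A (nus s) r
     + R (nus r) (nus s)
     - nu (icurv D (nus r) s - icurv D (nus s) r + nablaEndip D A r s) *+ 2).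
Proof.
have p := mixed_GG r s.
apply: E_ext => [|Z|];
  rewrite (nijenhuisT p, nijenhuisF _ p, nijenhuisG p) !J_inG.
- rewrite /= lieNl lieNr opprK zeroE subr0 (gbrC r).
  have -> xi : B (xi *+ 2) = B xi *+ 2 by exact: linearMn.
  by rewrite zeroE add0r opprB addrA addrAC.
- have E1 : Z (eip (inF G (mus r)) (inT G (nus s)))
      + Z (eip (inF G (mus r)) (inT G (nus s))) = Z (gip r (mu (nus s)) *+ 2).
    by rewrite -vfieldD -mulr2n eip_mulr2n /= !zeroE.
  rewrite !dorfmanF /= E1 !zeroE !mulN1r !dfunN !partnuN !(lieNl, partmuN).
  rewrite !(negE, gipDl).
  ring.
- rewrite !dorfmanG /= !(zeroE, negE) /nablaEnd !(partAD, partAN).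
  have -> xi : nu (xi *+ 2) = nu xi *+ 2 by exact: linearMn.
  apply: gip_ext => t.
  rewrite !(gipDl, gipNl, opprK); ring.
Qed.

Lemma nijenhuis_TF_G X xi : (nij (inT G X) (inF G xi)).2 =
  nab (J X) (nu xi) - nu (lie1 (J X) xi) - nab (B xi) (mu X)
     - mu (lie X (B xi)) + gbr (mu X) (nu xi)
     - nu (contr3 (B xi) X H - lie1 X (Jd xi) - icurv D X (nu xi) *+ 2)
     - A (nab X (nu xi) + R X (B xi)) + R (J X) (B xi).
Proof.
rewrite (nijenhuisG (mixed_TF X xi)) J_inT J_inF !dorfmanG /= !zeroE.
rewrite -!addrA partnuD.
apply: gip_ext => t.
rewrite !(gipDl, gipNl, opprD) [A (_ + R _ _)]partAD.
ring.
Qed.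

End Components.

Theorem theorem28 (K : realType) (M : manifold K)
    (M_nonempty : [set: M] !=set0) (M_connected : connected [set: M])
    (G : quadratic_lie_bundle M) (D : courant_data G)
    (E_neutral : neutral_signature G) (JJ : gacs G) :
  let R := curv D in let H := threeform D in let nab := nabla D in
  let J := partJ JJ in let Jd := dualJ JJ in
  let A := partA JJ in
  let B := partB JJ in let B2 := partB2 JJ in
  let C := partC JJ in let C2 := partC2 JJ in
  let mu := partmu JJ in let mus := adjmu JJ in
  let nu := partnu JJ in let nus := adjnu JJ in
  gacs_integrable D JJ <->
  (* (1) *)
  (forall X Y : vfield M,
     lie (J X) (J Y) - lie X Y - J (lie X (J Y)) + J (lie Y (J X))
     + B (contr3 X (J Y) H + contr3 (J X) Y H + contr3 X Y (d2 C2)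
          - C (lie X Y))
     + B (icurv D X (mu Y) - icurv D Y (mu X)) *+ 2
     + nus (R X (J Y) - R Y (J X) + nab X (mu Y) - nab Y (mu X)) = 0)
  (* (2) *)
  /\ (forall X Y : vfield M,
     contr3 (J Y) (J X) H - contr3 Y X H
     + Jd (contr3 (J Y) X H - contr3 (J X) Y H)
     + icurv D (J Y) (mu X) *+ 2 - icurv D (J X) (mu Y) *+ 2
     - Jd (icurv D X (mu Y) - icurv D Y (mu X)) *+ 2
     + lie2 (J X) C2 Y - lie2 (J Y) C2 X + dfun (C2 X (J Y))
     + Jd (contr3 Y X (d2 C2) + C (lie X Y))
     + nablaip D (mu X) (mu Y) *+ 2
     + mus (R X (J Y) + R (J X) Y + nab X (mu Y) - nab Y (mu X)) = 0)
  (* (3) *)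
  /\ (forall X Y : vfield M,
     R (J X) (J Y) - R X Y + nab (J X) (mu Y) - nab (J Y) (mu X)
     + gbr (mu X) (mu Y) - mu (lie X (J Y) - lie Y (J X))
     + nu (contr3 X (J Y) H + contr3 (J X) Y H + contr3 X Y (d2 C2)
           - C (lie X Y))
     + nu (icurv D X (mu Y) - icurv D Y (mu X)) *+ 2
     - A (R X (J Y) - R Y (J X) + nab X (mu Y) - nab Y (mu X)) = 0)
  (* (4) *)
  /\ (forall xi eta : oneform M,
     lie (B xi) (B eta) - B (lie1 (B xi) eta - lie1 (B eta) xi)
     + B (dfun (B2 xi eta)) = 0)
  (* (5) *)
  /\ (forall xi eta : oneform M,
     lie1 (B eta) (Jd xi) - lie1 (B xi) (Jd eta) + dfun (B2 (Jd xi) eta)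
     + Jd (lie1 (B xi) eta - lie1 (B eta) xi - dfun (B2 xi eta))
     - (icurv D (B xi) (nu eta) - icurv D (B eta) (nu xi)) *+ 2
     + nablaip D (nu xi) (nu eta) *+ 2
     + contr3 (B eta) (B xi) H = 0)
  (* (6) *)
  /\ (forall xi eta : oneform M,
     R (B xi) (B eta) + nab (B xi) (nu eta) - nab (B eta) (nu xi)
     + gbr (nu xi) (nu eta)
     - nu (lie1 (B xi) eta - lie1 (B eta) xi - dfun (B2 xi eta)) = 0)
  (* (7) *)
  /\ (forall r s : vsection G,
     lie (nus r) (nus s)
     - B (icurv D (nus r) s - icurv D (nus s) r + nablaEndip D A r s) *+ 2
     + nus (gbr (A r) s - gbr (A s) r - nab (nus r) s + nab (nus s) r) = 0)
  (* (8) *)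
  /\ (forall r s : vsection G,
     contr3 (nus s) (nus r) H + lie1 (nus r) (mus s) - lie1 (nus s) (mus r)
     + dfun (eip (inF G (mus r)) (inT G (nus s))) *+ 2
     + (icurv D (nus r) (A s) - icurv D (nus s) (A r)
        + nablaip D (A r) (A s) - nablaip D r s) *+ 2
     + Jd (icurv D (nus r) s - icurv D (nus s) r + nablaEndip D A r s) *+ 2
     + mus (gbr (A r) s + gbr r (A s) - nab (nus r) s + nab (nus s) r) = 0)
  (* (9) *)
  /\ (forall r s : vsection G,
     gbr (A r) (A s) - gbr r s - A (gbr (A r) s + gbr r (A s))
     - nablaEnd D A (nus r) s + nablaEnd D A (nus s) r
     + R (nus r) (nus s)
     - nu (icurv D (nus r) s - icurv D (nus s) r + nablaEndip D A r s) *+ 2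
     = 0)
  (* (10) *)
  /\ (forall (X : vfield M) (xi : oneform M),
     nab (J X) (nu xi) - nu (lie1 (J X) xi) - nab (B xi) (mu X)
     - mu (lie X (B xi)) + gbr (mu X) (nu xi)
     - nu (contr3 (B xi) X H - lie1 X (Jd xi) - icurv D X (nu xi) *+ 2)
     - A (nab X (nu xi) + R X (B xi)) + R (J X) (B xi) = 0).
Proof.
move=> R H nab J Jd A B B2 C C2 mu mus nu nus.
rewrite integrable_nijenhuis; split=> [N0|].
  have TT X Y := etrans (esym (nijenhuis_TT D JJ X Y)) (N0 _ _).
  have FF xi eta := etrans (esym (nijenhuis_FF D JJ xi eta)) (N0 _ _).
  have GG r s := etrans (esym (nijenhuis_GG D JJ r s)) (N0 _ _).
  split; first by move=> X Y; exact: (congr1 (fun u : _ * _ * _ => u.1.1) (TT X Y)).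
  split; first by move=> X Y; exact: (congr1 (fun u : _ * _ * _ => u.1.2) (TT X Y)).
  split; first by move=> X Y; exact: (congr1 (fun u : _ * _ * _ => u.2) (TT X Y)).
  split; first by move=> xi eta; exact: (congr1 (fun u : _ * _ * _ => u.1.1) (FF xi eta)).
  split; first by move=> xi eta; exact: (congr1 (fun u : _ * _ * _ => u.1.2) (FF xi eta)).
  split; first by move=> xi eta; exact: (congr1 (fun u : _ * _ * _ => u.2) (FF xi eta)).
  split; first by move=> r s; exact: (congr1 (fun u : _ * _ * _ => u.1.1) (GG r s)).
  split; first by move=> r s; exact: (congr1 (fun u : _ * _ * _ => u.1.2) (GG r s)).
  split; first by move=> r s; exact: (congr1 (fun u : _ * _ * _ => u.2) (GG r s)).
  by move=> X xi; rewrite -[LHS]nijenhuis_TF_G N0.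
move=> [TT1 [TT2 [TT3 [FF1 [FF2 [FF3 [GG1 [GG2 [GG3 TF3]]]]]]]]].
apply: nijenhuis_eq0 => [X Y|xi eta|r s|X xi].
- by rewrite nijenhuis_TT TT1 TT2 TT3.
- by rewrite nijenhuis_FF FF1 FF2 FF3.
- by rewrite nijenhuis_GG GG1 GG2 GG3.
- by rewrite nijenhuis_TF_G TF3.
Qed.
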